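(* Let $F\in L^1(\mathcal F_\infty,\mathbf W)$. Then the $((\mathcal F_t)_{t\ge0},W)$-martingale $(M_t(F))_{t\ge0}$ vanishes on the zeros of $(X_u)_{u\ge0}$ if and only if $k_g(F)=0$ ($\mathbf W$-a.e.).
   Context: $\Omega=\mathcal C(\mathbb R_+\to\mathbb R)$, $(X_t)$ is the coordinate process, $\mathcal F_t=\sigma(X_s,s\le t)$, $\mathcal F_\infty=\bigvee_t\mathcal F_t$, $W$ is Wiener measure with $W(X_0=0)=1$; $\mu(Z)$ denotes the integral of $Z$ under $\mu$. $(L_t)$ is the local time at $0$ (density of occupation with respect to Lebesgue measure), $L_\infty=\lim_tL_t$; $g=\sup\{t\ge0:X_t=0\}$. $\mathcal F_g$ is the $\sigma$-field generated by the variables $\Phi_g$, $\Phi$ predictable. $\mathbf W$ is the $\sigma$-finite measure on $(\Omega,\mathcal F_\infty)$ defined by $\mathbf W=2e^{L_\infty/2}\cdot W^{(\delta_0)}_\infty$, where $W^{(\delta_0)}_\infty$ is the probability characterized by $W^{(\delta_0)}_\infty|_{\mathcal F_t}=(1+\frac12|X_t|)e^{-L_t/2}\cdot W|_{\mathcal F_t}$ for all $t\ge0$. (Case $q=\delta_0$ of $\mathbf W=\varphi_q(0)e^{\frac12A^{(q)}_\infty}\cdot W^{(q)}_\infty$, which does not depend on $q$.) Under $\mathbf W$, $g<\infty$ a.e. For $F\in L^1(\mathcal F_\infty,\mathbf W)$ (not necessarily of constant sign), $(M_t(F))$ is the continuous $W$-martingale characterized by $\mathbf W(F\Gamma_t)=W(M_t(F)\Gamma_t)$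 for all $t\ge0$ and all bounded $\mathcal F_t$-measurable $\Gamma_t$. The predictable process $(k_s(F))_{s\ge0}$, defined $dL_s(\omega)W(d\omega)$-a.e., is characterized by $$\mathbf W(\Phi_gF)=W\left(\int_0^\infty\Phi_s\,k_s(F)\,dL_s\right)=\mathbf W(\Phi_g\,k_g(F))\quad\text{for every bounded predictable }\Phi,$$ so that $k_g(F)=\mathbf W(F|\mathcal F_g)$. *)

(* Defs.v *)
From HB Require Import structures.
From mathcomp Require Import all_boot all_order all_algebra.
From mathcomp Require Import all_classical all_reals all_analysis.
Set Implicit Arguments.
Unset Strict Implicit.
Unset Printing Implicit Defensive.
Import Order.TTheory GRing.Theory Num.Theory.
Import numFieldTopology.Exports numFieldNormedType.Exports.

Local Open Scope classical_set_scope.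
Local Open Scope ring_scope.

Definition Rplus (R : realType) : set R := `[0, +oo[.

Lemma mem0_Rplus (R : realType) : (0 : R) \in @Rplus R.
Proof. by rewrite inE /Rplus /= in_itv /= lexx. Qed.

Definition time0 (R : realType) : set_type (@Rplus R) :=
  SigSub (mem0_Rplus R).

Definition Omega (R : realType) : Type :=
  continuousType (set_type (@Rplus R)) R.

Definition zero_path (R : realType) : Omega R :=
  mkcts (fun x => @cst_continuous (set_type (@Rplus R)) R (0 : R) x).

HB.instance Definition _ (R : realType) := Choice.on (Omega R).
HB.instance Definition _ (R : realType) :=
  isPointed.Build (Omega R) (zero_path R).

Section processes.
Variable R : realType.
Implicit Types (t s T : R) (w : Omega R).

(* Processes are indexed by R rather than by R_+, so that they can be
   integrated against measures on R; only nonnegative times are relevant.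
   For t < 0, X t w is w 0. *)
Definition X t w : R := (w : continuousType _ _) (insubd (time0 R) t).

Definition Ft t : set (set (Omega R)) :=
  <<s \bigcup_(s in `[0, t]) preimage_set_system setT (X s) measurable >>.

Definition Ft_measurable t (f : Omega R -> R) : Prop :=
  @measurable_fun _ _ (g_sigma_algebraType (Ft t)) R setT f.

Definition predictable_rect : set (set (R * Omega R)) :=
  [set [set 0] `*` A | A in Ft 0] `|`
  [set C | exists s t A,
     [/\ 0 <= s, s <= t, Ft s A & C = `]s, t]%classic `*` A]].

Definition predictable (Phi : R -> Omega R -> R) : Prop :=
  @measurable_fun _ _ (g_sigma_algebraType predictable_rect) R
    (@Rplus R `*` setT) (fun p => Phi p.1 p.2).

End processes.

HB.instance Definition _ (R : realType) :=
  Measurable.copy (Omega R)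
    (g_sigma_algebraType (\bigcup_(t in @Rplus R) @Ft R t)).

Section brownian.
Variable R : realType.
Implicit Types (t s T : R) (w : Omega R).
Implicit Types (W Wd : probability (Omega R) R).
Implicit Types (WW : {measure set (Omega R) -> \bar R}).

Definition is_wiener W : Prop :=
  W [set w | X 0 w = 0] = 1%E /\
  forall s t A (B : set R), 0 <= s -> s < t -> Ft s A -> measurable B ->
    W (A `&` [set w | B (X t w - X s w)]) =
    (W A * normal_prob 0 (Num.sqrt (t - s)) B)%E.

(* l x t w is the local time at level x and time t: the jointly continuous
   density of the occupation measure of w on [0, t].  The exceptional sets are
   null sets of the F_T, T < oo, and not merely of F_oo: a null set of F_T is
   also null for the penalised measures, whereas these are singular with
   respect to W on F_oo. *)
Definition is_local_time W (l : R -> R -> Omega R -> R) : Prop :=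
  (forall x t, 0 <= t -> Ft_measurable t (l x t)) /\
  forall T, 0 <= T -> exists N, [/\ Ft T N, W N = 0%E &
    forall w, ~ N w ->
      {within [set: R] `*` `[0, T]%classic,
        continuous (fun p : R * R => l p.1 p.2 w)} /\
      forall t (A : set R), 0 <= t -> t <= T -> measurable A ->
        lebesgue_measure [set s | 0 <= s <= t /\ A (X s w)] =
        (\int[lebesgue_measure]_(x in A) (l x t w)%:E)%E].

Definition Linfty (L : R -> Omega R -> R) w : \bar R :=
  lim ((L t w)%:E @[t --> +oo]).

(* The measure with distribution function f; the zero measure if f is not
   nondecreasing and right-continuous. *)
Definition stieltjes (f : R -> R) :
    {measure set (measurableTypeR R) -> \bar R} :=
  match pselect (exists c : cumulative R R, (c : R -> R) = f) with
  | left h => lebesgue_stieltjes_measure (projT1 (cid h))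
  | right _ => mzero
  end.

Definition dL (L : R -> Omega R -> R) w :
    {measure set (measurableTypeR R) -> \bar R} :=
  stieltjes (fun t => L (Num.max 0 t) w).

Definition is_W_delta0 W (L : R -> Omega R -> R) Wd : Prop :=
  forall t A, 0 <= t -> Ft t A ->
    Wd A = (\int[W]_(w in A)
      ((1 + 2^-1 * `|X t w|) * expR (- (L t w / 2)))%:E)%E.

Definition is_bold_W (L : R -> Omega R -> R) Wd WW : Prop :=
  forall A, measurable A ->
    WW A = (\int[Wd]_(w in A) (2%:E * expeR (2^-1%:E * Linfty L w)))%E.

(* g is +oo if the zeros of w are unbounded (a negligible event for WW); at_g
   then uses the time fine +oo = 0. *)
Definition g w : \bar R :=
  ereal_sup [set t%:E | t in [set t | 0 <= t /\ X t w = 0]].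

Definition at_g (Phi : R -> Omega R -> R) w : R := Phi (fine (g w)) w.

Definition continuous_martingale W (M : R -> Omega R -> R) : Prop :=
  [/\ forall t, 0 <= t -> Ft_measurable t (M t),
      forall t, 0 <= t -> W.-integrable setT (EFin \o M t),
      forall s t A, 0 <= s -> s <= t -> Ft s A ->
        (\int[W]_(w in A) (M t w)%:E = \int[W]_(w in A) (M s w)%:E)%E &
      {ae W, forall w, {within @Rplus R, continuous (fun t => M t w)}}].

Definition is_M W WW (F : Omega R -> R) (M : R -> Omega R -> R) : Prop :=
  continuous_martingale W M /\
  forall t (Gam : Omega R -> R), 0 <= t ->
    Ft_measurable t Gam -> (exists C, forall w, `|Gam w| <= C) ->
    (\int[WW]_w (F w * Gam w)%:E = \int[W]_w (M t w * Gam w)%:E)%E.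

Definition is_k W (L : R -> Omega R -> R) WW (F : Omega R -> R)
    (k : R -> Omega R -> R) : Prop :=
  [/\ predictable k,
      (\int[W]_w \int[dL L w]_(s in @Rplus R) `|k s w|%:E < +oo)%E,
      WW.-integrable setT (EFin \o at_g k) &
      forall Phi : R -> Omega R -> R, predictable Phi ->
        (exists C, forall t w, 0 <= t -> `|Phi t w| <= C) ->
        (\int[WW]_w (at_g Phi w * F w)%:E =
         \int[W]_w \int[dL L w]_(s in @Rplus R) (Phi s w * k s w)%:E)%E /\
        (\int[WW]_w (at_g Phi w * F w)%:E =
         \int[WW]_w (at_g Phi w * at_g k w)%:E)%E].

End brownian.

(* Main.v *)
Require Import Defs.
From mathcomp Require Import all_boot all_order all_algebra.
From mathcomp Require Import all_classical all_reals all_analysis.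
From mathcomp Require Import measurable_realfun ring lra.
Import Order.TTheory GRing.Theory Num.Theory.
Import numFieldTopology.Exports numFieldNormedType.Exports.
Import HBNNSimple.
Set Implicit Arguments.
Unset Strict Implicit.
Unset Printing Implicit Defensive.
Local Open Scope classical_set_scope.
Local Open Scope ring_scope.

(** For a time s, let T be the first zero of the path after s. If A is an event
    of F_s, the martingale property of M stopped at T gives
      [WW (F; A, T <= t) = W (M_t; A, T <= t) = W (M_T; A, T <= t)].
    Hence, if M vanishes on the zeros, F has integral 0 over the part of A where
    T is finite; conversely, if F has integral 0 over all these parts, M
    vanishes at T almost surely. Now T is finite exactly when the path has a zero
    after s, and under WW the last zero g is finite, so that up to null sets
    they are the parts of A where s < g. Together with F_0 they generate F_g, and
    k_g is the conditional expectation of F given F_g: so F has integral 0 over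
    all of them if and only if k_g = 0.

    Each direction rests on a lemma about a martingale at the first zero, which
    is proved by locating T in the cells of a finer and finer grid:
    [optional_stopping_le] for the direct implication, and [first_zero_le0] for
    the converse, where the information is about the events on which T comes
    after u, for all u and all A in F_u. From there [vanishing_M] passes to all
    zeros by continuity, since every positive zero is a limit of first zeros
    after rational times. The passage from the parts of A where s < g to F_g is
    the pi-lambda theorem ([Rintegral_predictable_eq0]).

    The finiteness of g ([g_finite]) comes from the definition of WW. The
    density of Wd with respect to W on F_t is the martingale
    [(1 + `|X t| / 2) * exp (- L t / 2)], which at T is at most
    [exp (- L s / 2)]; so the Wd-probability of a zero after s is at most the
    W-expectation of [exp (- L s / 2)]. That tends to 0 as s grows: the density
    has expectation 1 and [`|X s|] is large with high probability. *)

(** * Integrals over sets *)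

Lemma Rintegral_le0 d (T : measurableType d) (R : realType)
    (mu : {measure set T -> \bar R}) (D : set T) (f : T -> R) :
  (forall x, D x -> f x <= 0) -> \int[mu]_(x in D) f x <= 0.
Proof.
move=> f0; apply: fine_le0; rewrite integralE.
rewrite [X in (X - _)%E](_ : _ = 0%E) ?sub0e ?oppe_le0 ?integral_ge0//.
apply: integral0_eq => x Dx; rewrite funeposE.
by apply/max_idPr; rewrite lee_fin f0.
Qed.

(** The integral of a nonnegative function is a supremum over the simple
    functions below it, and these vanish off [V]. The function is arbitrary
    because it will involve [Linfty], a limit that need not exist for every
    path. *)
Lemma ge0_null_integral d (T : measurableType d) (R : realType)
    (mu : {measure set T -> \bar R}) (V : set T) (f : T -> \bar R) :
  measurable V -> mu V = 0%E -> (forall x, (0 <= f x)%E) ->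
  (\int[mu]_(x in V) f x)%E = 0%E.
Proof.
move=> mV V0 f0; apply/eqP; rewrite eq_le integral_ge0// andbT.
rewrite integral_mkcond ge0_integralTE; last by move=> x; rewrite patchE; case: ifP.
apply: ge_ereal_sup => _ [h /= hf <-].
rewrite -integralT_nnsfun (_ : (fun x => _) = (EFin \o h) \_ V); last first.
  apply/funext => x /=; rewrite patchE; case: ifPn => // xV.
  apply/eqP; rewrite eq_le; have := hf x; rewrite patchE (negbTE xV) => -> /=.
  by have : (0 <= (h x)%:E)%E by rewrite lee_fin.
rewrite -integral_mkcond null_set_integral//.
exact/measurable_EFinP/measurable_funTS.
Qed.

Section vanishing_sets.
Context d (T : measurableType d) (R : realType).
Variable mu : {measure set T -> \bar R}.
Variable f : T -> R.
Hypothesis intf : mu.-integrable setT (EFin \o f).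

Lemma integrable_on (A : set T) : measurable A -> mu.-integrable A (EFin \o f).
Proof. by move=> mA; apply: (integrableS _ mA _ intf). Qed.

Lemma Rintegral_setD (A B : set T) : measurable A -> measurable B -> B `<=` A ->
  \int[mu]_(x in A) f x = \int[mu]_(x in B) f x + \int[mu]_(x in A `\` B) f x.
Proof.
move=> mA mB BA; rewrite -[in LHS](setDUK BA) Rintegral_setU//.
- exact: measurableD.
- by rewrite setDUK//; exact: integrable_on.
- by apply/disj_setPLR => x Bx [].
Qed.

Lemma Rintegral_bigcup_ord n (A : nat -> set T) :
  (forall i, (i < n)%N -> measurable (A i)) -> trivIset setT A ->
  \int[mu]_(x in \bigcup_(i < n) A i) f x =
  \sum_(i < n) \int[mu]_(x in A i) f x.
Proof.
move=> + tA; elim: n => [mA|n IH mA].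
  by rewrite big_ord0 II0 bigcup_set0 Rintegral_set0.
have mA' i : (i < n)%N -> measurable (A i) by move=> ni; apply: mA; exact: ltnW.
have mU : measurable (\bigcup_(i < n) A i) by apply: bigcup_measurable.
rewrite big_ord_recr/= -IH// IIS bigcup_setU bigcup_set1 Rintegral_setU//.
- exact: mA.
- by apply: integrable_on; apply: measurableU => //; exact: mA.
- apply/disj_setPLR => x [i /= ni Ai] An.
  have E : i = n by apply: (tA i n I I); exists x.
  by rewrite E ltnn in ni.
Qed.

(** Dominated convergence, for the indicators of sets that almost every point
    eventually leaves. It absorbs all the error terms of the discretisations
    below. *)
Lemma Rintegral_vanishing_sets (B : nat -> set T) :
  (forall m, measurable (B m)) ->
  {ae mu, forall w, \forall m \near \oo, ~ B m w} ->
  (\int[mu]_(x in B m) `|f x|) @[m --> \oo] --> (0 : R).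
Proof.
move=> mB aeB.
pose h : T -> \bar R := fun x => `|f x|%:E.
have mn : measurable_fun setT h.
  have /integrableP[/measurable_EFinP mf _] := intf.
  by apply/measurable_EFinP; apply: measurableT_comp.
have [||||| _ _] := @dominated_convergence _ T R mu setT measurableT
  (fun m => h \_ (B m)) (cst 0%E) h.
- by move=> m; apply/(measurable_restrictT _ (mB m)); apply: measurable_funTS.
- by [].
- apply: filterS aeB => w Bw _; apply: cvg_near_cst.
  by apply: filterS Bw => m /= nB; rewrite patchE memNset.
- exact: integrable_abse intf.
- apply: aeW => x m _; rewrite patchE; case: ifPn => _; first by rewrite /h/= normr_id.
  by rewrite abse0 /h lee_fin.
rewrite integral0 => H.
have {}H : (fine \o (fun m => \int[mu]_x (h \_ (B m)) x))%E m @[m --> \oo] --> (0:R).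
  exact: fine_cvg H.
have -> // : (fun m => \int[mu]_(x in B m) `|f x|) =
  fine \o (fun m => \int[mu]_x (h \_ (B m)) x)%E.
by apply/funext => m /=; rewrite -integral_mkcond.
Qed.

Lemma Rintegral_nondecreasing_eq0 (A : nat -> set T) :
  (forall m, measurable (A m)) -> nondecreasing_seq A ->
  (forall m, \int[mu]_(x in A m) f x = 0) ->
  \int[mu]_(x in \bigcup_m A m) f x = 0.
Proof.
move=> mA ndA A0; set C := \bigcup_m A m.
have mC : measurable C by apply: bigcup_measurable.
apply/eqP; rewrite -normr_le0.
have H : (\int[mu]_(x in C `\` A m) `|f x|) @[m --> \oo] --> (0 : R).
  apply: Rintegral_vanishing_sets => [m|]; first exact: measurableD.
  apply: aeW => w; have [[m _ Am]|nC] := pselect (C w).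
    exists m => // p /= mp [_]; apply.
    by have /subsetPset := ndA _ _ mp; exact.
  by apply: nearW => m [].
apply: (ler_cvg_to (cvg_cst _) H); apply: nearW => m.
rewrite (@Rintegral_setD C (A m))// ?A0 ?add0r; last exact: bigcup_sup.
by apply: le_normr_Rintegral; [exact: measurableD|apply: integrable_on; exact: measurableD].
Qed.

End vanishing_sets.

Section sets_up_to_null.
Context d (T : measurableType d) (R : realType).
Variable mu : {measure set T -> \bar R}.
Variable f : T -> R.
Hypothesis intf : mu.-integrable setT (EFin \o f).

Lemma Rintegral_indic (A : set T) :
  \int[mu]_w (f w * \1_A w) = \int[mu]_(w in A) f w.
Proof.
rewrite [RHS]Rintegral_mkcond; apply: eq_Rintegral => w _.
by rewrite patchE indicE; case: (w \in A); rewrite ?mulr1 ?mulr0.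
Qed.

Lemma eq_Rintegral_ae_set (A B : set T) : measurable A -> measurable B ->
  {ae mu, forall w, A w <-> B w} ->
  \int[mu]_(w in A) f w = \int[mu]_(w in B) f w.
Proof.
move=> mA mB AB; rewrite /Rintegral; congr fine.
rewrite integral_mkcond [RHS]integral_mkcond; apply: ae_eq_integral => //.
- by apply/(measurable_restrictT _ mA); exact: measurable_int (integrable_on intf mA).
- by apply/(measurable_restrictT _ mB); exact: measurable_int (integrable_on intf mB).
- apply: filterS AB => w [AB BA] _; rewrite !patchE.
  have -> // : (w \in A) = (w \in B).
  by apply/idP/idP => /set_mem => [/AB|/BA] /mem_set.
Qed.

(** The integral of [`|f|] splits into those of [f] and of [- f] over the two
    sets where [f] has a constant sign. *)
Lemma ae_eq0_of_Rintegral_sign :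
  \int[mu]_(w in [set w | 0 < f w]) f w = 0 ->
  \int[mu]_(w in ~` [set w | 0 < f w]) f w = 0 -> {ae mu, forall w, f w = 0}.
Proof.
have mf : measurable_fun setT f by apply/measurable_EFinP; exact: measurable_int intf.
set P := [set w | 0 < f w].
have mP : measurable P.
  rewrite (_ : P = f @^-1` `]0, +oo[); first by rewrite -[X in measurable X]setTI; exact: mf.
  by apply/seteqP; split=> w; rewrite /P/= in_itv/= andbT.
have mPc : measurable (~` P) by exact: measurableC.
move=> P0 Pc0.
have intn := integrable_abse intf.
have P0' : \int[mu]_(w in P) `|f w| = 0.
  by rewrite -P0; apply: eq_Rintegral => w /set_mem /ltW /ger0_norm.
have Pc0' : \int[mu]_(w in ~` P) `|f w| = 0.
  transitivity (\int[mu]_(w in ~` P) ((-1) * f w)).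
    apply: eq_Rintegral => w /set_mem /negP; rewrite -leNgt => /ler0_norm ->.
    by rewrite mulN1r.
  by rewrite RintegralZl ?Pc0 ?mulr0//; exact: integrable_on.
have := Rintegral_setD intn measurableT mP (@subsetT _ _).
rewrite setTD => H.
have {}H : (\int[mu]_w `|f w|%:E)%E = 0%E.
  rewrite -[LHS]fineK; first by congr EFin; rewrite [LHS]H P0' Pc0' addr0.
  exact: integrable_fin_num.
have mfE : measurable_fun setT (EFin \o f) by exact/measurable_EFinP.
have := (ae_eq_integral_abs mu measurableT mfE).1 H.
by apply: filterS => w /(_ I) [].
Qed.

End sets_up_to_null.

(** * Zeros of a path and the filtration *)

Section paths.
Variable R : realType.
Implicit Types (s t u v : R) (w : Omega R).

(** [X] extends a path to negative times by its value at 0, so it is the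
    composition of a continuous function on the half-line with [Num.max 0]. *)
Lemma continuous_path w : continuous (fun t => X t w).
Proof.
have ci : continuous (insubd (time0 R) : R -> set_type (@Rplus R)).
  apply: (@continuous_comp_initial _ _ _ set_val).
  have -> : set_val \o (insubd (time0 R) : R -> set_type (@Rplus R)) =
            Num.max (0 : R).
    apply/funext => t /=; rewrite set_valE val_insubd.
    have -> : (t \in [in @Rplus R]) = (0 <= t).
      by rewrite -topredE/= mem_setE in_itv/= andbT.
    by rewrite /=; case: (leP 0 t).
  move=> t; apply: continuous_max; first exact: cvg_cst.
  exact: cvg_id.
move=> t; pose w' : continuousType (set_type (@Rplus R)) R := w.
exact: (@continuous_comp _ _ _ (insubd (time0 R) : R -> set_type (@Rplus R))
  w' t (ci t) (@cts_fun _ _ w' _)).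
Qed.

Definition zero_in s t : set (Omega R) :=
  [set w | exists z, s <= z <= t /\ X z w = 0].

Definition first_zero s w z : Prop :=
  [/\ s <= z, X z w = 0 & forall r, s <= r -> r < z -> X r w != 0].

(** The zeros in a compact interval form a compact set, which has a least
    element. *)
Lemma zero_in_first s t w : zero_in s t w ->
  exists2 z, z <= t & first_zero s w z.
Proof.
move=> [z0 [z0st Xz0]].
pose K := `[s, t] `&` ((fun r => X r w) @^-1` [set 0]).
have K0 : K !=set0 by exists z0; split=> //=; rewrite in_itv.
have cK : compact K.
  apply: compact_closedI; first exact: segment_compact.
  apply: (@preimage_closed _ _ (fun r => X r w)); last exact: closed_eq.
  by move=> x _; exact: continuous_path.
have [] := @compact_EVT_min _ R id K K0 cK.
  by apply: continuous_subspaceT => r; exact: cvg_id.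
move=> z /set_mem[/= + Xz] minz; rewrite in_itv/= => /andP[sz zt].
exists z => //; split=> // r sr rz; apply/negP => /eqP Xr.
have : r \in K by apply/mem_set; split=> //=; rewrite in_itv/= sr/= (le_trans (ltW rz)).
by move/minz; rewrite leNgt rz.
Qed.

Lemma first_zero_in s w z t : first_zero s w z -> zero_in s t w <-> z <= t.
Proof.
move=> [sz Xz zmin]; split=> [[r [/andP[sr rt] Xr]]|zt].
  rewrite leNgt; apply/negP => tz.
  by have := zmin r sr (le_lt_trans rt tz); rewrite Xr eqxx.
by exists z; rewrite sz zt.
Qed.

(** A continuous path has a zero in [[s, t]] when the infimum of its modulus over
    a countable dense set of times is 0. Clipping the rationals to [[s, t]] is
    what makes the event depend on the times before [t] only. *)
Lemma zero_in_itvE s t : s <= t -> zero_in s t =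
  \bigcap_p \bigcup_(q : rat)
    [set w | `|X (Num.min t (Num.max s (ratr q))) w| < p.+1%:R^-1].
Proof.
move=> st; pose c (r : R) := Num.min t (Num.max s r).
have cc : continuous c.
  move=> r; apply: continuous_min; first exact: cvg_cst.
  apply: continuous_max; [exact: cvg_cst|exact: cvg_id].
have cin r : s <= c r <= t by rewrite /c le_min st le_max lexx ge_min lexx.
have cf w : continuous (fun r => `|X (c r) w|).
  move=> r; apply: (@continuous_comp _ _ _ (fun r => X (c r) w)).
    exact: (@continuous_comp _ _ _ c (fun r => X r w) r (cc r)
      (@continuous_path w (c r))).
  exact: norm_continuous.
apply/seteqP; split=> [w [z [/andP[sz zt] Xz]] p _|w Hw].
  have [y [/= yp [q _ qy]]] : (fun r => `|X (c r) w|) @^-1` [set y | y < p.+1%:R^-1]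
      `&` range (@ratr R) !=set0.
    apply: dense_rat.
      exists z => /=; rewrite /c (max_idPr sz) (min_idPr zt) Xz normr0.
      by rewrite invr_gt0.
    apply: open_comp => [x _|]; first exact: cf.
    exact: open_lt.
  by exists q => //=; rewrite qy.
have [|z zst zmin] := @EVT_min R (fun r => `|X r w|) s t st.
  apply: continuous_subspaceT => r; apply: continuous_comp.
    exact: continuous_path.
  exact: norm_continuous.
exists z; split; first by move: zst; rewrite in_itv.
apply/eqP; rewrite -normr_le0 leNgt; apply/negP => Xz0.
have [p pz] := ltr_add_invr Xz0; rewrite add0r in pz.
have [q _ /= /(lt_trans) /(_ pz)] := Hw p I.
by rewrite ltNge zmin// in_itv/= cin.
Qed.

End paths.

Section filtration.
Variable R : realType.
Implicit Types (s t u v : R) (w : Omega R) (A B : set (Omega R)).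

(* F_t as the sigma-algebra of a measurable type *)
Local Notation OmegaF t := (g_sigma_algebraType
  (\bigcup_(s in `[0, t]) preimage_set_system setT (@X R s) measurable)).

Lemma Ft_setT t : Ft t (@setT (Omega R)).
Proof. exact: (@measurableT _ (OmegaF t)). Qed.

Lemma Ft_setI t A B : Ft t A -> Ft t B -> Ft t (A `&` B).
Proof. exact: (@measurableI _ (OmegaF t)). Qed.

Lemma Ft_setD t A B : Ft t A -> Ft t B -> Ft t (A `\` B).
Proof. exact: (@measurableD _ (OmegaF t)). Qed.

Lemma Ft_le s t : s <= t -> Ft s `<=` @Ft R t.
Proof.
move=> st; apply: sub_sigma_algebra2; apply: bigcup_subset => r /=.
by rewrite !in_itv/= => /andP[-> /le_trans]; exact.
Qed.

Lemma Ft_measurable_set t A : 0 <= t -> Ft t A -> measurable A.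
Proof.
move=> t0 FA; apply: sub_sigma_algebra; exists t => //.
by rewrite /Rplus/= in_itv/= t0.
Qed.

Lemma Ft_preimage t (f : Omega R -> R) (B : set R) :
  Ft_measurable t f -> measurable B -> Ft t (f @^-1` B).
Proof.
move=> mf mB; have := mf (@measurableT _ _) B mB.
by rewrite setTI /measurable/= sigma_algebra_id//; exact: smallest_sigma_algebra.
Qed.

Lemma Ft_measurable_fun t (f : Omega R -> R) :
  0 <= t -> Ft_measurable t f -> measurable_fun setT f.
Proof.
move=> t0 mf _ B mB; rewrite setTI.
by apply: (Ft_measurable_set t0); exact: Ft_preimage.
Qed.

Lemma Ft_measurable_X t : 0 <= t -> Ft_measurable t (@X R t).
Proof.
move=> t0 _ B mB; apply: sub_sigma_algebra; apply: sub_sigma_algebra.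
by exists t => /=; [rewrite in_itv/= t0 lexx|exists B].
Qed.

Lemma Ft_zero_in s t : 0 <= s -> Ft t (@zero_in R s t).
Proof.
move=> s0; have [st|ts] := leP s t; last first.
  rewrite (_ : zero_in s t = setT `\` setT); first by apply: Ft_setD; exact: Ft_setT.
  rewrite setDv -subset0 => w [z [/andP[/le_trans h /h]]].
  by rewrite leNgt ts.
rewrite (zero_in_itvE st).
apply: (@bigcapT_measurable _ (OmegaF t)) => p.
apply: (@bigcupT_measurable_rat _ (OmegaF t)) => q.
set c := Num.min _ _.
have /andP[sc ct] : s <= c <= t by rewrite /c le_min st le_max lexx ge_min lexx.
apply: (Ft_le ct).
pose B := [set y : R | `|y| < p.+1%:R^-1].
apply: (@Ft_preimage c (X c) B).
  by apply: Ft_measurable_X; exact: le_trans sc.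
apply: open_measurable; rewrite /B.
apply: (@open_comp _ _ (fun y : R => `|y|) [set y | y < p.+1%:R^-1]) => [y _|].
  exact: norm_continuous.
exact: open_lt.
Qed.

Lemma Ft_first_hit s u v A : 0 <= s -> u <= v -> Ft u A ->
  Ft v (A `&` (zero_in s v `\` zero_in s u)).
Proof.
move=> s0 uv FA; apply: Ft_setI; first exact: Ft_le uv _ FA.
apply: Ft_setD; first exact: Ft_zero_in.
by apply: (Ft_le uv); exact: Ft_zero_in.
Qed.

End filtration.

(** * Discretisation of the first zero *)

Section grid.
Variable R : realType.
Variables s t : R.
Hypothesis st : s < t.
Implicit Types (u v z : R) (w : Omega R) (m i : nat).

Definition grid m i : R := s + (t - s) * (i%:R / m.+1%:R).

Lemma grid0 m : grid m 0 = s.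
Proof. by rewrite /grid mul0r mulr0 addr0. Qed.

Lemma grid_last m : grid m m.+1 = t.
Proof. by rewrite /grid divff ?pnatr_eq0// mulr1 addrC subrK. Qed.

Lemma gridS m i : grid m i.+1 = grid m i + (t - s) / m.+1%:R.
Proof. by rewrite /grid -addrA -mulrDr -[X in _ / _ + X]mul1r -mulrDl natr1. Qed.

Lemma grid_le m i j : (i <= j)%N -> grid m i <= grid m j.
Proof.
move=> ij; rewrite /grid lerD2l ler_pM2l ?subr_gt0//.
by rewrite ler_pM2r ?ler_nat.
Qed.

Lemma grid_ge m i : s <= grid m i.
Proof. by rewrite -[leLHS](grid0 m) grid_le. Qed.

Lemma grid_le_end m i : (i <= m.+1)%N -> grid m i <= t.
Proof. by move=> im; rewrite -[leRHS](grid_last m) grid_le. Qed.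

(** The first zero after [s] falls in the half-open cell from [grid m i] to
    [grid m i.+1] ([hitP]); written as a difference, the event is visibly known
    at time [grid m i.+1]. *)
Definition hit m i : set (Omega R) :=
  zero_in s (grid m i.+1) `\` zero_in s (grid m i).

Lemma hitP m i w z : first_zero s w z ->
  hit m i w <-> grid m i < z <= grid m i.+1.
Proof.
move=> sz; rewrite /hit; split=> [[/(first_zero_in _ sz) z2 /(first_zero_in _ sz)/negP]|].
  by rewrite -ltNge => ->.
case/andP => gz /(first_zero_in _ sz) zg; split=> //.
by move/(first_zero_in _ sz); rewrite leNgt gz.
Qed.

(** The cells do not see a zero at the time [s] itself, whence the difference. *)
Lemma bigcup_hit m :
  \bigcup_(i < m.+1) hit m i = zero_in s t `\` zero_in s s.
Proof.
apply/seteqP; split=> [w [i /= im hi]|w [zt zs]].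
  have [z _ sz] := zero_in_first hi.1.
  have /andP[gz zg] := (hitP m i sz).1 hi.
  split; first by apply/(first_zero_in _ sz); exact: le_trans (grid_le_end im).
  by move/(first_zero_in _ sz); rewrite leNgt (le_lt_trans (grid_ge m i) gz).
have [z zle sz] := zero_in_first zt.
have sz' : s < z by rewrite ltNge; apply/negP => /(first_zero_in _ sz).
have ex : exists i, z <= grid m i.+1 by exists m; rewrite grid_last.
pose i := ex_minn ex.
have [zi imin] : z <= grid m i.+1 /\ forall j, z <= grid m j.+1 -> (i <= j)%N.
  by rewrite /i; case: ex_minnP => j zj jm; split.
exists i => /=; first by rewrite ltnS; apply: imin; rewrite grid_last.
apply/(hitP m i sz); rewrite zi andbT ltNge; apply/negP.
case: i imin {zi} => [_|i imin /imin]; first by rewrite grid0 leNgt sz'.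
by rewrite ltnn.
Qed.

Lemma trivIset_hit m : trivIset setT (hit m).
Proof.
have ndF : nondecreasing_seq (fun i => zero_in s (grid m i)).
  move=> i j ij; apply/subsetPset => w [z [/andP[sz zg] Xz]].
  by exists z; rewrite sz (le_trans zg)// grid_le.
have /trivIsetP h := trivIset_seqD ndF; apply/trivIsetP => i j _ _ ij.
exact: (h i.+1 j.+1).
Qed.

Lemma Ft_hit m i : 0 <= s -> Ft (grid m i.+1) (hit m i).
Proof.
move=> s0; apply: Ft_setD; first exact: Ft_zero_in.
by apply: (@Ft_le _ (grid m i)); [exact: grid_le|exact: Ft_zero_in].
Qed.

(** The mesh tends to 0, so both ends of the cell that contains the first zero
    tend to it. *)
Lemma cvg_grid_hit w z (N : R -> R) e :
  {within `[s, t], continuous N} -> first_zero s w z -> z <= t -> 0 < e ->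
  \forall m \near \oo, forall i, (i < m.+1)%N -> hit m i w ->
    `|N z - N (grid m i)| < e /\ `|N z - N (grid m i.+1)| < e.
Proof.
move=> cN sz zt e0.
have sz' : s <= z by case: sz.
have : N @ within `[s, t] (nbhs z) --> N z.
  by apply: (subspace_continuousP _ _).1 cN _ _; rewrite /= in_itv/= sz' zt.
move/cvgr_dist_lt => /(_ e e0); rewrite near_withinE => -[/= d d0 Nd].
have ts0 : 0 < t - s by rewrite subr_gt0.
have [M] := ltr_add_invr (divr_gt0 d0 ts0); rewrite add0r ltr_pdivlMr// => Md.
exists M => // m /= Mm i im /(hitP m i sz) /andP[gz zg].
have h : (t - s) / m.+1%:R < d.
  apply: le_lt_trans Md; rewrite mulrC ler_pM2r// lef_pV2 ?posrE//.
  by rewrite ler_nat ltnS.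
have {h} : grid m i.+1 < grid m i + d by rewrite gridS ltrD2l.
move: (grid m i.+1) (grid m i) gz zg (grid_ge m i) (grid_ge m i.+1)
  (grid_le_end im) (grid_le_end (ltnW im)) => v u uz zv su sv vt ut h.
split; apply: Nd => /=; rewrite ?in_itv/= ?su ?ut ?sv ?vt//.
- by rewrite gtr0_norm ?subr_gt0//; lra.
- by rewrite ler0_norm ?subr_le0//; lra.
Qed.

End grid.

(** * Martingales at the first zero *)

Section stopping.
Variable R : realType.
Variables (W : probability (Omega R) R) (s t : R) (N : R -> Omega R -> R).
Hypotheses (s0 : 0 <= s) (st : s < t).
Implicit Types (u v z : R) (w : Omega R) (A : set (Omega R)).

Hypothesis adaptedN : forall u, s <= u -> u <= t -> Ft_measurable u (N u).
Hypothesis integrableN : forall u, s <= u -> u <= t ->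
  W.-integrable setT (EFin \o N u).
Hypothesis martingaleN : forall u v A, s <= u -> u <= v -> v <= t -> Ft u A ->
  \int[W]_(w in A) N v w = \int[W]_(w in A) N u w.
Hypothesis continuousN :
  {ae W, forall w, {within `[s, t], continuous (fun u => N u w)}}.

Local Notation g := (grid s t).

Let measurable_Ft u A : s <= u -> Ft u A -> measurable A.
Proof. by move=> su; apply: Ft_measurable_set; exact: le_trans su. Qed.

Let Ft_gt u a : s <= u -> u <= t -> Ft u [set w | a < N u w].
Proof.
move=> su ut; rewrite (_ : [set w | _] = N u @^-1` `]a, +oo[).
  by apply: Ft_preimage => //; exact: adaptedN.
by apply/seteqP; split=> w /=; rewrite in_itv/= andbT.
Qed.

(** Optional stopping at the first zero T in ]s, t], in the form of an
    inequality: if [N] is at most [Y] at T, then the integral of [N t] over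
    an event of F_s on which T exists is at most that of [Y]. On the cell
    that contains T, the martingale property replaces [N t] by the value of
    [N] at the right end of the cell. By continuity this value exceeds [Y + e]
    only on events whose indicators tend to 0, and there one goes back to
    the fixed integrable variable [N t]. *)
Lemma optional_stopping_le (Y : Omega R -> R) A :
  Ft_measurable s Y -> W.-integrable setT (EFin \o Y) -> Ft s A ->
  {ae W, forall w z, first_zero s w z -> s < z -> z <= t -> N z w <= Y w} ->
  \int[W]_(w in A `&` (zero_in s t `\` zero_in s s)) N t w <=
  \int[W]_(w in A `&` (zero_in s t `\` zero_in s s)) Y w.
Proof.
move=> mY intY FA NY; set E := A `&` _.
have FE : Ft t E.
  apply: Ft_setI; first exact: Ft_le (ltW st) _ FA.
  apply: Ft_setD; first exact: Ft_zero_in.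
  by apply: (Ft_le (ltW st)); exact: Ft_zero_in.
have mE : measurable E by apply: measurable_Ft FE; exact: ltW.
apply/ler_addgt0Pr => e e0.
pose D := fun u w => N u w - (Y w + e).
have intYe : W.-integrable setT (EFin \o (fun w => Y w + e)).
  have := integrableD measurableT intY (finite_measure_integrable_cst W e measurableT).
  by apply: eq_integrable.
have intD u : s <= u -> u <= t -> W.-integrable setT (EFin \o D u).
  move=> su ut; have := integrableB measurableT (integrableN su ut) intYe.
  by apply: eq_integrable.
have FD u a : s <= u -> u <= t -> Ft u [set w | a < D u w].
  move=> su ut; rewrite (_ : [set w | _] = D u @^-1` `]a, +oo[); last first.
    by apply/seteqP; split=> w /=; rewrite in_itv/= andbT.
  apply: Ft_preimage => //; apply: measurable_funB; first exact: adaptedN.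
  apply: measurable_funD; last exact: measurable_cst.
  move=> _ B mB; rewrite setTI; apply: sub_sigma_algebra.
  by apply: (Ft_le su); exact: Ft_preimage.
pose bad m i := (A `&` hit s t m i) `&` [set w | 0 < D (g m i.+1) w].
pose Bad m := \bigcup_(i < m.+1) bad m i.
have gs m i : s <= g m i by exact: grid_ge.
have gt m i : (i < m.+1)%N -> g m i.+1 <= t by exact: grid_le_end.
have FAh m i : Ft (g m i.+1) (A `&` hit s t m i).
  by apply: Ft_setI; [exact: Ft_le FA|exact: Ft_hit].
have Fbad m i : (i < m.+1)%N -> Ft (g m i.+1) (bad m i).
  by move=> im; apply: Ft_setI; [exact: FAh|apply: FD => //; exact: gt].
have mAh m i : measurable (A `&` hit s t m i).
  exact: (@measurable_Ft (g m i.+1)).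
have mbad m i : (i < m.+1)%N -> measurable (bad m i).
  by move=> im; apply: (@measurable_Ft (g m i.+1)) => //; exact: Fbad.
have mBad m : measurable (Bad m) by apply: bigcup_measurable => i /= /mbad.
have martD u B : s <= u -> u <= t -> Ft u B ->
    \int[W]_(w in B) D t w = \int[W]_(w in B) D u w.
  move=> su ut FB; have mB := measurable_Ft su FB.
  have iN v : s <= v -> v <= t -> W.-integrable B (EFin \o N v).
    by move=> sv vt; apply: integrable_on => //; exact: integrableN.
  rewrite /D !RintegralB//;
    [|exact: iN|exact: integrable_on|apply: iN => //; exact: ltW|exact: integrable_on].
  by rewrite (martingaleN su ut).
have trivAh m : trivIset setT (fun i => A `&` hit s t m i).
  by apply: trivIset_setIl; exact: trivIset_hit.
have trivbad m : trivIset setT (bad m) by exact: trivIset_setIr.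
have hit_le m i : (i < m.+1)%N ->
    \int[W]_(w in A `&` hit s t m i) D t w <= \int[W]_(w in bad m i) `|D t w|.
  move=> im; have intDt := intD t (ltW st) (lexx t).
  rewrite (Rintegral_setD intDt (mAh m i) (mbad m i im)); last by move=> w [].
  have FAb : Ft (g m i.+1) ((A `&` hit s t m i) `\` bad m i).
    by apply: Ft_setD; [exact: FAh|exact: Fbad].
  rewrite (martD _ _ (gs m i.+1) (gt m i im) FAb).
  rewrite -[leRHS]addr0; apply: lerD.
    apply: le_trans (ler_norm _) _; apply: le_normr_Rintegral; first exact: mbad.
    by apply: integrable_on => //; exact: mbad.
  apply: Rintegral_le0 => w [Aw] /not_andP[//|/negP].
  by rewrite -leNgt.
have E_le m : \int[W]_(w in E) D t w <= \int[W]_(w in Bad m) `|D t w|.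
  have intDt := intD t (ltW st) (lexx t).
  rewrite /E -(bigcup_hit st m) setI_bigcupr.
  rewrite (Rintegral_bigcup_ord intDt)// Rintegral_bigcup_ord//; last 2 first.
  - exact: (integrable_abse intDt).
  - exact: mbad.
  by apply: ler_sum => i _; exact: hit_le.
have Bad0 : (\int[W]_(w in Bad m) `|D t w|) @[m --> \oo] --> (0 : R).
  apply: Rintegral_vanishing_sets => //; first exact: intD (ltW st) (lexx t).
  have := NY; apply: filterS2 continuousN => w cw NYw.
  have [[hw nw]|nE] := pselect ((zero_in s t `\` zero_in s s) w); last first.
    apply: nearW => m [i /= im [[_ hi] _]]; apply: nE.
    by rewrite -(bigcup_hit st m); exists i.
  have [z zt sz] := zero_in_first hw.
  have sz' : s < z by rewrite ltNge; apply/negP => /(first_zero_in _ sz).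
  have := cvg_grid_hit st cw sz zt e0; apply: filterS => m H [i /= im [[_ hi] /=]].
  have [_] := H i im hi; rewrite ltr_distlC => /andP[_ Nlt].
  by apply/negP; rewrite -leNgt subr_le0 (le_trans (ltW Nlt))// lerD2r NYw.
have : \int[W]_(w in E) D t w <= 0.
  apply: (ler_cvg_to (cvg_cst _) Bad0); exact: nearW.
rewrite /D RintegralB//; last 2 first.
- by apply: integrable_on => //; exact: integrableN (ltW st) (lexx t).
- exact: integrable_on.
rewrite subr_le0 => /le_trans; apply.
rewrite RintegralD//; last 2 first.
- exact: integrable_on.
- have := finite_measure_integrable_cst W e measurableT.
  by move/integrable_on; apply.
rewrite lerD2l Rintegral_cst// ler_piMr//; first exact: ltW.
by rewrite -lee_fin fineK ?probability_le1// fin_num_measure.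
Qed.

(** A converse of optional stopping: if the integral of [N v] over the part of A
    where the first zero T lies in ]u, v] is 0 for all u and v and all A in F_u,
    then [N] is nonpositive at T. On a cell, look at the event
    [P] that [N] exceeds b at the left end. There [N] at the right end has
    integral 0, so its positive part, at least [b * W C], is compensated by its
    negative part, which lives on [Q]. As the martingale property moves the
    integral over [Q] to [N t], and as continuity makes [Q] disappear in the
    limit, the events [C] lose all their mass; but they finally contain each path
    with [N] above 2 b at T. *)
Lemma first_zero_le0 :
  (forall u v A, s <= u -> u <= v -> v <= t -> Ft u A ->
    \int[W]_(w in A `&` (zero_in s v `\` zero_in s u)) N v w = 0) ->
  {ae W, forall w z, first_zero s w z -> s < z -> z <= t -> N z w <= 0}.
Proof.
move=> N0.
have gs m i : s <= g m i by exact: grid_ge.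
have gle m i : (i < m.+1)%N -> g m i.+1 <= t by exact: grid_le_end.
have gle' m i : (i < m.+1)%N -> g m i <= t by move=> im; exact: grid_le_end (ltnW im).
have gS m i : g m i <= g m i.+1 by exact: grid_le.
have intNt := integrableN (ltW st) (lexx t).
suff NR (a : R) : 0 < a ->
    {ae W, forall w z, first_zero s w z -> s < z -> z <= t -> N z w <= a}.
  have : {ae W, forall w (p : nat) z, first_zero s w z -> s < z -> z <= t ->
      N z w <= p.+1%:R^-1}.
    by apply/ae_foralln => p; apply: NR; rewrite invr_gt0.
  apply: filterS => w Nw z sz sz' zt; rewrite leNgt; apply/negP => N0z.
  have [p] := ltr_add_invr N0z; rewrite add0r.
  by rewrite ltNge Nw.
move=> a0; set b := a / 2; have b0 : 0 < b by rewrite divr_gt0.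
pose P m i := [set w | b < N (g m i) w] `&` hit s t m i.
pose Q m i := P m i `\` [set w | 0 < N (g m i.+1) w].
pose C m i := P m i `&` [set w | b < N (g m i.+1) w].
pose QQ m := \bigcup_(i < m.+1) Q m i.
pose CC m := \bigcup_(i < m.+1) C m i.
have FP m i : (i < m.+1)%N -> Ft (g m i.+1) (P m i).
  move=> im; apply: Ft_setI; last exact: Ft_hit.
  by apply: (Ft_le (gS m i)); apply: Ft_gt => //; exact: gle'.
have FQ m i : (i < m.+1)%N -> Ft (g m i.+1) (Q m i).
  by move=> im; apply: Ft_setD; [exact: FP|apply: Ft_gt => //; exact: gle].
have FC m i : (i < m.+1)%N -> Ft (g m i.+1) (C m i).
  by move=> im; apply: Ft_setI; [exact: FP|apply: Ft_gt => //; exact: gle].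
have mP m i : (i < m.+1)%N -> measurable (P m i).
  by move=> im; apply: (@measurable_Ft (g m i.+1)) => //; exact: FP.
have mQ m i : (i < m.+1)%N -> measurable (Q m i).
  by move=> im; apply: (@measurable_Ft (g m i.+1)) => //; exact: FQ.
have mC m i : (i < m.+1)%N -> measurable (C m i).
  by move=> im; apply: (@measurable_Ft (g m i.+1)) => //; exact: FC.
have mQQ m : measurable (QQ m) by apply: bigcup_measurable => i /= /mQ.
have mCC m : measurable (CC m) by apply: bigcup_measurable => i /= /mC.
have trivP m : trivIset setT (P m) by apply: trivIset_setIl; exact: trivIset_hit.
have trivQ m : trivIset setT (Q m).
  by rewrite /Q; under eq_fun do rewrite setDE; apply: trivIset_setIr; exact: trivP.
have trivC m : trivIset setT (C m) by exact: trivIset_setIr.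
have intb : W.-integrable setT (EFin \o cst b).
  exact: finite_measure_integrable_cst.
have C_le m i : (i < m.+1)%N ->
    \int[W]_(w in C m i) b <= \int[W]_(w in Q m i) `|N t w|.
  move=> im; set v := g m i.+1.
  have intN := integrableN (gs m i.+1) (gle m i im).
  have QP : Q m i `<=` P m i by exact: subDsetl.
  have P0 : \int[W]_(w in P m i) N v w = 0.
    by apply: N0 => //; [exact: gle|apply: Ft_gt => //; exact: gle'].
  have CPQ : C m i `<=` P m i `\` Q m i.
    by move=> w [Pw Nw]; split=> // -[_]; apply; exact: lt_trans b0 Nw.
  have mPQ : measurable (P m i `\` Q m i) by apply: measurableD; [exact: mP|exact: mQ].
  apply: (@le_trans _ _ (\int[W]_(w in C m i) N v w)).
    apply: le_Rintegral; [exact: mC|..|by move=> w [_] /ltW].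
    - exact: (integrable_on intb (mC m i im)).
    - exact: (integrable_on intN (mC m i im)).
  apply: (@le_trans _ _ (\int[W]_(w in P m i `\` Q m i) N v w)).
    rewrite (Rintegral_setD intN mPQ (mC m i im) CPQ) lerDl.
    apply: Rintegral_ge0 => w [[Pw nQ] _]; rewrite leNgt; apply/negP => Nw.
    by apply: nQ; split=> //= /(lt_trans Nw); rewrite ltxx.
  have := Rintegral_setD intN (mP m i im) (mQ m i im) QP.
  rewrite P0 => /esym/eqP; rewrite addrC addr_eq0 => /eqP ->.
  rewrite -(martingaleN (gs m i.+1) (gle m i im) (lexx t) (FQ m i im)).
  apply: le_trans (ler_norm _) _; rewrite normrN; apply: le_normr_Rintegral; first exact: mQ.
  exact: (integrable_on intNt (mQ m i im)).
have CC_le m : b * fine (W (CC m)) <= \int[W]_(w in QQ m) `|N t w|.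
  rewrite -(Rintegral_cst W (mCC m)).
  rewrite (Rintegral_bigcup_ord intb)//; last exact: mC.
  rewrite (Rintegral_bigcup_ord (integrable_abse intNt))//; last exact: mQ.
  by apply: ler_sum => i _; exact: C_le.
have QQ0 : (\int[W]_(w in QQ m) `|N t w|) @[m --> \oo] --> (0 : R).
  apply: Rintegral_vanishing_sets => //.
  apply: filterS continuousN => w cw.
  have [[hw nw]|nE] := pselect ((zero_in s t `\` zero_in s s) w); last first.
    apply: nearW => m [i /= im [[_ hi] _]]; apply: nE.
    by rewrite -(bigcup_hit st m); exists i.
  have [z zt sz] := zero_in_first hw.
  have b20 : 0 < b / 2 by rewrite divr_gt0.
  have := cvg_grid_hit st cw sz zt b20; apply: filterS => m H [i /= im [[/= bN hi]]].
  have [H1 H2] := H i im hi; apply.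
  by move: H1 H2; rewrite !ltr_distlC => /andP[_ ?] /andP[? _]; lra.
have null k : W (\bigcap_(m in [set m | (k <= m)%N]) CC m) = 0%E.
  have mcap : measurable (\bigcap_(m in [set m | (k <= m)%N]) CC m).
    by apply: bigcap_measurable => //; exists k => /=.
  have fin B : measurable B -> W B \is a fin_num by exact: fin_num_measure.
  rewrite -(fineK (fin _ mcap)); congr EFin; apply/eqP.
  rewrite eq_le fine_ge0// andbT -(pmulr_rle0 _ b0).
  apply: (ler_cvg_to (cvg_cst _) QQ0); exists k => // m /= km.
  apply: le_trans (CC_le m); rewrite ler_pM2l// fine_le ?fin//.
  by apply: le_measure; rewrite ?inE//; exact: bigcap_inf.
have : {ae W, forall w k, ~ (\bigcap_(m in [set m | (k <= m)%N]) CC m) w}.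
  apply/ae_foralln => k.
  exists (\bigcap_(m in [set m | (k <= m)%N]) CC m); split; last by move=> w /contrapT.
    by apply: bigcap_measurable => //; exists k => /=.
  exact: null.
apply: filterS2 continuousN => w cw nCC z sz sz' zt; rewrite leNgt; apply/negP => aN.
have [k _ H] := cvg_grid_hit st cw sz zt b0.
apply: (nCC k) => m /= km.
have : (zero_in s t `\` zero_in s s) w.
  split; first by apply/(first_zero_in _ sz).
  by move/(first_zero_in _ sz); rewrite leNgt sz'.
rewrite -(bigcup_hit st m) => -[i /= im hi].
have [] := H m km i im hi; rewrite !ltr_distlC => /andP[H1 _] /andP[H2 _].
have ab : a = b + b by rewrite /b; lra.
exists i => //; split; [split=> //|] => /=; lra.
Qed.

End stopping.

(** * Gaussian estimates *)

Section wiener.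
Variable R : realType.
Variables (W : probability (Omega R) R).
Hypothesis hW : is_wiener W.
Implicit Types (s t u v z : R) (w : Omega R).

(** The Gaussian density is at most the inverse of the standard deviation. *)
Lemma wiener_ball t K : 0 < t -> 0 <= K ->
  (W [set w | `|X t w| <= K]%R <= (K * 2 / Num.sqrt t)%:E)%E.
Proof.
move=> t0 K0; have [X00 incr] := hW.
have mX s : 0 <= s -> measurable_fun setT (@X R s).
  by move=> s0; exact: (Ft_measurable_fun s0 (Ft_measurable_X s0)).
have mX0 := mX 0 (lexx 0); have mXt := mX t (ltW t0).
pose B := `[- K, K]%classic : set R.
have mB : measurable B by exact: measurable_itv.
pose Z := [set w | X 0 w = 0 :> R].
have mZ : measurable Z.
  rewrite (_ : Z = X 0 @^-1` [set 0])//; rewrite -[X in measurable X]setTI.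
  exact: mX0.
pose C := [set w | B (X t w - X 0 w)].
have mC : measurable C.
  rewrite -[X in measurable X]setTI.
  by apply: (measurable_funB mXt mX0).
have mK : measurable [set w | `|X t w| <= K].
  rewrite (_ : [set w | _] = X t @^-1` B).
    by rewrite -[X in measurable X]setTI; exact: mXt.
  by apply/seteqP; split=> w; rewrite /B/= in_itv/= ler_norml.
have sub : [set w | `|X t w| <= K] `<=` ~` Z `|` C.
  move=> w /= Xw; have [Z0|?] := pselect (Z w); [right|by left].
  by rewrite /C /B/= [X 0 w]Z0 subr0 in_itv/= -ler_norml.
have WZ : W (~` Z) = 0%E by rewrite probability_setC// X00 subee.
apply: (@le_trans _ _ (W (~` Z `|` C))).
  by apply: le_measure; rewrite ?inE//; apply: measurableU => //; exact: measurableC.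
apply: le_trans (measureU2 _ _ _) _ => //; first exact: measurableC.
rewrite [X in (X + _)%E]WZ add0e.
have := incr 0 t setT B (lexx 0) t0 (@Ft_setT _ 0) mB.
rewrite setTI probability_setT mul1e subr0 -/C => WC.
apply: (@le_trans _ _ (W C)); first exact: lexx.
rewrite WC.
have st0 : 0 < Num.sqrt t by rewrite sqrtr_gt0.
rewrite /normal_prob.
apply: (@le_trans _ _ (\int[lebesgue_measure]_(x in B) (normal_peak (Num.sqrt t))%:E)%E).
  apply: ge0_le_integral => //.
  - by move=> x _; rewrite lee_fin normal_pdf_ge0.
  - by apply/measurable_EFinP/measurable_funTS; exact: measurable_normal_pdf.
  - by move=> x _; rewrite lee_fin normal_pdf_ub// gt_eqF.
rewrite integral_cst//= lebesgue_measure_itv/= lte_fin.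
case: ifPn => _; last by rewrite mule0 lee_fin divr_ge0 ?mulr_ge0// ltW.
rewrite -EFinD -EFinM lee_fin opprK -mulr2n -[K *+ 2]mulr_natr mulrC.
rewrite ler_wpM2l ?mulr_ge0// /normal_peak lef_pV2 ?posrE//.
  rewrite -mulr_natr -mulrA sqrtrM ?sqr_ge0// sqrtr_sqr gtr0_norm//.
  apply: ler_peMr; first exact: ltW.
  rewrite -[leLHS]sqrtr1 ler_wsqrtr//.
  by have := pi_ge2 R; lra.
by rewrite sqrtr_gt0 pmulrn_lgt0// mulr_gt0 ?pi_gt0// exprn_gt0.
Qed.

Lemma wiener_neq0 t : 0 < t -> {ae W, forall w, X t w != 0}.
Proof.
move=> t0; exists [set w | `|X t w| <= 0]%R; split.
- rewrite (_ : [set w | _] = X t @^-1` [set 0]).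
    rewrite -[X in measurable X]setTI.
    by apply: (Ft_measurable_fun (ltW t0) (Ft_measurable_X (ltW t0))).
  by apply/seteqP; split=> w /=; rewrite normr_le0 => /eqP.
- apply/eqP; rewrite eq_le measure_ge0 andbT.
  by apply: le_trans (wiener_ball t0 (lexx 0)) _; rewrite !mul0r.
- by move=> w /= /negP; rewrite negbK => /eqP ->; rewrite normr0.
Qed.

End wiener.

(** * Regularity of the local time *)

Section local_time.
Variable R : realType.
Implicit Types (s t T : R) (w : Omega R).

(** If the inequality failed at [x], it would fail by a fixed margin on a small
    interval around [x]. *)
Lemma le_of_le_integral (f h : R -> R) (x : R) : continuous f -> continuous h ->
  (forall A : set R, measurable A ->
    (\int[lebesgue_measure]_(y in A) (f y)%:E <=
     \int[lebesgue_measure]_(y in A) (h y)%:E)%E) ->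
  f x <= h x.
Proof.
move=> cf ch fh; rewrite leNgt; apply/negP => hf.
have [p [q [hp [pq qf]]]] : exists p q, h x < p /\ p < q /\ q < f x.
  by exists ((f x + 2 * h x) / 3), ((2 * f x + h x) / 3); split; [|split]; lra.
have [d /= d0 Hd] : \forall y \near x, h y < p /\ q < f y.
  near=> y; split; near: y.
    exact: (cvgr_lt (h x) (ch x)).
  exact: (cvgr_gt (f x) (cf x)).
pose A := `[x - d / 2, x + d / 2]%classic : set R.
have d20 : 0 < d / 2 by rewrite divr_gt0.
have mA : measurable A by exact: measurable_itv.
have HA y : A y -> h y < p /\ q < f y.
  rewrite /A/= in_itv/= => /andP[y1 y2]; apply: Hd => /=.
  by rewrite ltr_norml; apply/andP; split; lra.
have intA (e : R -> R) : continuous e -> lebesgue_measure.-integrable A (EFin \o e).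
  move=> ce; apply: continuous_compact_integrable; first exact: segment_compact.
  exact: continuous_subspaceT.
have muA : lebesgue_measure A = d%:E.
  rewrite lebesgue_measure_itv/= lte_fin ifT; last by lra.
  by rewrite -EFinD; congr EFin; lra.
have intc (e : R) : lebesgue_measure.-integrable A (EFin \o (fun=> e)).
  by apply: intA => y; exact: cvg_cst.
have hle : (\int[lebesgue_measure]_(y in A) (h y)%:E <=
           \int[lebesgue_measure]_(y in A) p%:E)%E.
  apply: le_integral => //; [exact: intA|exact: intc|].
  by move=> y /set_mem /HA[/ltW ? _]; rewrite lee_fin.
have fle : (\int[lebesgue_measure]_(y in A) q%:E <=
           \int[lebesgue_measure]_(y in A) (f y)%:E)%E.
  apply: le_integral => //; [exact: intc|exact: intA|].
  by move=> y /set_mem /HA[_ /ltW ?]; rewrite lee_fin.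
have := le_trans fle (le_trans (fh A mA) hle).
rewrite !integral_cst//= muA -!EFinM lee_fin ler_pM2r//.
by rewrite leNgt pq.
Unshelve. all: by end_near. Qed.

Variables (W : probability (Omega R) R) (l : R -> R -> Omega R -> R).
Hypothesis hl : is_local_time W l.

(** The occupation measure of a path on [[0, t]] is nonnegative and increases
    with [t]; its density at the single level 0 inherits both properties because
    it is continuous in the level. *)
Lemma local_time_regular T : 0 <= T -> {ae W, forall w,
  [/\ {within `[0, T], continuous (fun t => l 0 t w)},
      forall t, 0 <= t -> t <= T -> 0 <= l 0 t w &
      forall s t, 0 <= s -> s <= t -> t <= T -> l 0 s w <= l 0 t w]}.
Proof.
move=> T0; have [N [FN WN HN]] := hl.2 T T0.
exists N; split => //; first exact: Ft_measurable_set T0 FN.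
move=> w; apply: contra_notP => /HN[cl occ]; clear HN.
have cl' := (subspace_continuousP _ _).1 cl.
have ct x : 0 <= x -> x <= T -> continuous (fun y => l y x w).
  move=> x0 xT y.
  have D z : ([set: R] `*` `[0, T]%classic) (z, x) by split=> //=; rewrite in_itv/= x0.
  have hc : (z, x) @[z --> y] --> (y, x).
    exact: (@cvg_pair R R R (nbhs y) (nbhs y) (nbhs x) _ _ _ id (fun=> x)
      cvg_id (cvg_cst x)).
  move=> U HU.
  have h : \forall z \near y, ([set: R] `*` `[0, T]%classic) (z, x) -> U (l z x w).
    exact: (hc _ (cl' _ (D y) U HU)).
  by apply: (filterS _ h) => z; apply; exact: D.
have mO t A : measurable A -> measurable [set s | 0 <= s <= t /\ A (X s w)].
  move=> mA; rewrite (_ : [set s | _] = `[0, t] `&` (fun s => X s w) @^-1` A).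
    apply: measurableI; first exact: measurable_itv.
    rewrite -[X in measurable X]setTI.
    by apply: continuous_measurable_fun => //; exact: continuous_path.
  by apply/seteqP; split=> s /=; rewrite in_itv/=.
split.
- apply/subspace_continuousP => x xT.
  have D z : `[0, T]%classic z -> ([set: R] `*` `[0, T]%classic) (0, z) by split.
  have hc : (0 : R, z) @[z --> x] --> (0 : R, x).
    exact: (@cvg_pair R R R (nbhs x) (nbhs (0 : R)) (nbhs x) _ _ _
      (fun=> 0) id (cvg_cst 0) cvg_id).
  move=> U HU.
  have h : \forall z \near x, ([set: R] `*` `[0, T]%classic) (0, z) -> U (l 0 z w).
    exact: (hc _ (cl' _ (D x xT) U HU)).
  by apply: (filterS _ h) => z Hz /D; exact: Hz.
- move=> t t0 tT; apply: (@le_of_le_integral (cst 0) (fun y => l y t w)).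
  + by move=> y; exact: cvg_cst.
  + exact: ct.
  + by move=> A mA; rewrite -occ// integral0.
- move=> s t s0 st tT; have t0 := le_trans s0 st; have sT := le_trans st tT.
  apply: (@le_of_le_integral (fun y => l y s w) (fun y => l y t w)).
  + exact: ct.
  + exact: ct.
  + move=> A mA; rewrite -!occ//; apply: le_measure; rewrite ?inE; try exact: mO.
    by move=> r /= [/andP[-> /le_trans ->]].
Qed.
End local_time.

(** * Finiteness of the last zero *)

Section penalised.
Variable R : realType.
Variables (W : probability (Omega R) R) (l : R -> R -> Omega R -> R).
Variables (Wd : probability (Omega R) R) (WW : {measure set (Omega R) -> \bar R}).
Hypotheses (hW : is_wiener W) (hl : is_local_time W l).
Hypotheses (hWd : is_W_delta0 W (l 0) Wd) (hWW : is_bold_W (l 0) Wd WW).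
Implicit Types (s t u v K : R) (w : Omega R).

(** [density t] is the density of [Wd] with respect to [W] on F_t; it is thus a
    martingale, and at a zero of the path it reduces to [decay t]. *)
Definition decay t w : R := expR (- (l 0 t w / 2)).
Definition density t w : R := (1 + 2^-1 * `|X t w|) * decay t w.

Let decay_ge0 t w : 0 <= decay t w. Proof. exact: expR_ge0. Qed.

Let density_ge0 t w : 0 <= density t w.
Proof. by rewrite mulr_ge0// addr_ge0// mulr_ge0. Qed.

Let decay_adapted t : 0 <= t -> Ft_measurable t (decay t).
Proof.
move=> t0; apply: measurableT_comp; first exact: measurable_expR.
apply: measurable_funN.
apply: measurable_funM; last exact: measurable_cst.
exact: hl.1.
Qed.

Let density_adapted t : 0 <= t -> Ft_measurable t (density t).
Proof.
move=> t0; apply: measurable_funM; last exact: decay_adapted.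
apply: measurable_funD; first exact: measurable_cst.
apply: measurable_funM; first exact: measurable_cst.
by apply: measurableT_comp => //; exact: Ft_measurable_X.
Qed.

Let measurable_density t : 0 <= t -> measurable_fun setT (density t).
Proof. by move=> t0; exact: Ft_measurable_fun t0 (density_adapted t0). Qed.

Let integrable_density t : 0 <= t -> W.-integrable setT (EFin \o density t).
Proof.
move=> t0; apply/integrableP; split.
  by apply/measurable_EFinP; exact: measurable_density.
have := hWd t0 (@Ft_setT _ t); rewrite probability_setT => h.
rewrite (_ : (\int[W]_x _)%E = 1%E) ?ltry// h.
by apply: eq_integral => w _ /=; rewrite ger0_norm.
Qed.

Let Rintegral_density t A : 0 <= t -> Ft t A ->
  fine (Wd A) = \int[W]_(w in A) density t w.
Proof. by move=> t0 FA; rewrite (hWd t0 FA). Qed.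

Let decay_le1 t : 0 <= t -> {ae W, forall w, decay t w <= 1}.
Proof.
move=> t0; have := local_time_regular hl t0; apply: filterS => w [_ l0 _].
by rewrite /decay -expR0 ler_expR oppr_le0 divr_ge0// l0.
Qed.

Let integrable_decay t : 0 <= t -> W.-integrable setT (EFin \o decay t).
Proof.
move=> t0; apply: (le_integrable _ _ _ (integrable_density t0)) => //.
  by apply/measurable_EFinP; exact: Ft_measurable_fun t0 (decay_adapted t0).
move=> w _; rewrite /= lee_fin !ger0_norm// /density ler_peMl//.
by rewrite lerDl mulr_ge0.
Qed.

(** Either [`|X t|] is at most [K], which is unlikely for large [t], or [decay t]
    is at most [2 / K * density t], which has integral at most [2 / K]. So the
    integral of [decay t] tends to 0, which is how the divergence of the local
    time enters. *)
Lemma Rintegral_decay_le t K : 0 < t -> 0 < K ->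
  \int[W]_w decay t w <= K * 2 / Num.sqrt t + 2 / K.
Proof.
move=> t0 K0; have t0' := ltW t0.
pose B := [set w | `|X t w| <= K]%R.
have mB : measurable B.
  rewrite (_ : B = X t @^-1` `[- K, K]%classic).
    rewrite -[X in measurable X]setTI.
    exact: (Ft_measurable_fun t0' (Ft_measurable_X t0')).
  by apply/seteqP; split=> w; rewrite /B/= in_itv/= ler_norml.
have WB : fine (W B) <= K * 2 / Num.sqrt t.
  by rewrite -lee_fin fineK ?fin_num_measure// wiener_ball// ltW.
have mBc : measurable (~` B) by exact: measurableC.
rewrite (Rintegral_setD (integrable_decay t0') measurableT mB)//; apply: lerD.
  apply: le_trans WB; rewrite -lee_fin fineK; last first.
    by apply: integrable_fin_num => //; exact: (integrable_on (integrable_decay t0')).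
  rewrite fineK ?fin_num_measure//.
  rewrite -[leRHS]mul1e -integral_cst//.
  apply: ae_ge0_le_integral => //.
  - by move=> w _; rewrite lee_fin.
  - exact: measurable_int (integrable_on (integrable_decay t0') mB).
  - by have := decay_le1 t0'; apply: filterS => w H _; rewrite lee_fin.
rewrite setTD; apply: (@le_trans _ _ (\int[W]_(w in ~` B) (2 / K * density t w))).
  apply: le_Rintegral => //.
  - exact: (integrable_on (integrable_decay t0')).
  - have := integrableZl measurableT (2 / K) (integrable_density t0').
    by move/integrable_on => /(_ _ mBc); apply: eq_integrable.
  - move=> w /negP; rewrite -ltNge => KX.
    rewrite /density mulrA ler_peMl// mulrDr mulr1.
    apply: (@le_trans _ _ (2 / K * (2^-1 * K))).
      by rewrite mulrACA divff// mulVf ?mulr1// gt_eqF.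
    rewrite -[leLHS]add0r; apply: lerD; first by rewrite divr_ge0// ltW.
    by rewrite ler_wpM2l ?divr_ge0 ?ler_wpM2l// ltW.
rewrite RintegralZl//; last exact: (integrable_on (integrable_density t0')).
apply: ler_piMr; first by rewrite divr_ge0// ltW.
have := Rintegral_setD (integrable_density t0') measurableT mBc (@subsetT _ _).
rewrite -(Rintegral_density t0' (@Ft_setT _ t)) probability_setT/= => h.
by rewrite [leRHS]h lerDl; apply: Rintegral_ge0.
Qed.

(** Optional stopping of [density] at the first zero after [s], where it equals
    [decay] and hence is at most [decay s] because the local time increases. *)
Lemma Wd_zero_in_le s t : 0 < s -> s < t ->
  fine (Wd (zero_in s t)) <= \int[W]_w decay s w.
Proof.
move=> s0 st; have s0' := ltW s0; have t0' := le_trans s0' (ltW st).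
have mZ u : 0 <= u -> measurable (@zero_in R s u).
  by move=> u0; apply: (Ft_measurable_set u0); exact: Ft_zero_in.
have mE : measurable (@zero_in R s t `\` zero_in s s).
  by apply: measurableD; exact: mZ.
have subZ : @zero_in R s s `<=` zero_in s t.
  by move=> w [z [/andP[sz zs] Xz]]; exists z; rewrite sz (le_trans zs (ltW st)).
have Zs0 : \int[W]_(w in zero_in s s) density t w = 0.
  rewrite /Rintegral null_set_integral ?fine0//; first exact: mZ.
    by apply/measurable_EFinP; apply: measurable_funTS; exact: measurable_density.
  apply/negligibleP; first exact: mZ.
  apply: negligibleS (wiener_neq0 hW s0) => w [z [/andP[sz zs] Xz]] /=.
  have <- : z = s by apply/eqP; rewrite eq_le sz zs.
  by rewrite Xz eqxx.
rewrite (Rintegral_density t0'); last exact: Ft_zero_in.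
rewrite (Rintegral_setD (integrable_density t0') (mZ t t0') (mZ s s0') subZ) Zs0 add0r.
apply: (@le_trans _ _ (\int[W]_(w in zero_in s t `\` zero_in s s) decay s w)); last first.
  have := Rintegral_setD (integrable_decay s0') measurableT mE (@subsetT _ _).
  by move=> ->; rewrite lerDl; apply: Rintegral_ge0.
have := @optional_stopping_le R W s t density s0' st _ _ _ _ (decay s) setT.
rewrite !setTI; apply.
- by move=> u su _; apply: density_adapted; exact: le_trans su.
- by move=> u su _; apply: integrable_density; exact: le_trans su.
- move=> u v A su uv _ FA; have u0 := le_trans s0' su.
  rewrite -(Rintegral_density u0 FA) -(Rintegral_density (le_trans u0 uv))//.
  exact: Ft_le uv _ FA.
- have := local_time_regular hl t0'; apply: filterS => w [cl _ _].
  have {}cl : {within `[s, t], continuous (fun u => l 0 u w)}.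
    apply: continuous_subspaceW cl => u /=; rewrite !in_itv/= => /andP[su ->].
    by rewrite (le_trans s0' su).
  move=> u; apply: cvgM.
    apply: cvgD; first exact: cvg_cst.
    apply: cvgM; first exact: cvg_cst.
    apply: cvg_norm.
    by apply: (@continuous_subspaceT _ _ _ (fun u => X u w)); exact: continuous_path.
  apply: (@cvg_comp _ _ _ _ expR); last exact: continuous_expR.
  apply: cvgN; apply: cvgM; last exact: cvg_cst.
  exact: cl.
- exact: decay_adapted.
- exact: integrable_decay.
- exact: Ft_setT.
- have := local_time_regular hl t0'; apply: filterS => w [_ _ mono] z [sz Xz _] sz' zt.
  rewrite /density Xz normr0 mulr0 addr0 mul1r /decay ler_expR lerN2.
  by rewrite ler_pM2r// mono.
Qed.

Lemma g_gt_zero_in s w : (s%:E < g w)%E -> exists t, s < t /\ zero_in s t w.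
Proof.
move=> /ereal_sup_gt[_ [t [t0 Xt] <-]]; rewrite lte_fin => st.
by exists t; split=> //; exists t; rewrite ltW//= lexx.
Qed.

(** A path with unbounded zeros has a zero after every time [s], which by the
    previous two bounds has a [Wd]-probability that tends to 0 as [s] grows. The
    measure [WW] has a density with respect to [Wd]. *)
Lemma g_finite : {ae WW, forall w, g w != +oo%E}.
Proof.
(* with s = x ^+ 4 and K = x, both terms of Rintegral_decay_le are 2 / x *)
pose s p : R := (p.+1%:R ^+ 2) ^+ 2.
pose U p := \bigcup_n @zero_in R (s p) (s p + n.+1%:R).
have s0 p : 0 < s p by rewrite /s !exprn_gt0.
have mZ p n : measurable (@zero_in R (s p) (s p + n.+1%:R)).
  apply: (@Ft_measurable_set _ (s p + n.+1%:R)); first by rewrite addr_ge0// ltW.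
  by apply: Ft_zero_in; exact: ltW.
have mU p : measurable (U p) by apply: bigcup_measurable.
have WdU p : (Wd (U p) <= (4 / p.+1%:R)%:E)%E.
  have ndZ : nondecreasing_seq (fun n => @zero_in R (s p) (s p + n.+1%:R)).
    move=> i j ij; apply/subsetPset => w [z [/andP[sz zs] Xz]].
    by exists z; rewrite sz (le_trans zs)// lerD2l ler_nat ltnS.
  have cvgZ := @nondecreasing_cvg_mu _ _ _ Wd _ (mZ p) (mU p) ndZ.
  rewrite -(cvg_lim _ cvgZ)//; apply: lime_le; first exact: (cvgP _ cvgZ).
  apply: nearW => n /=.
  rewrite -[leLHS]fineK ?fin_num_measure// lee_fin.
  apply: (le_trans (Wd_zero_in_le (s0 p) _)); first by rewrite ltrDl.
  apply: (le_trans (@Rintegral_decay_le (s p) p.+1%:R (s0 p) _)) => //.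
  rewrite /s sqrtr_sqr ger0_norm ?exprn_ge0//.
  have : p.+1%:R != 0 :> R by rewrite pnatr_eq0.
  by move: (p.+1%:R : R) => x x0; rewrite le_eqVlt; apply/orP; left; apply/eqP; field.
pose V := \bigcap_p U p.
have mV : measurable V by exact: bigcapT_measurable.
have WdV : Wd V = 0%E.
  apply/eqP; rewrite eq_le measure_ge0 andbT; apply/lee_addgt0Pr => e e0.
  have [p pe] := ltr_add_invr (divr_gt0 e0 (ltr0n R 4)).
  rewrite add0e; apply: (@le_trans _ _ (Wd (U p))).
    by apply: le_measure; rewrite ?inE//; exact: bigcap_inf.
  apply: le_trans (WdU p) _; rewrite lee_fin mulrC -ler_pdivlMr//.
  by rewrite ltW// -[ltLHS]add0r.
exists V; split=> //.
  rewrite hWW//; apply: ge0_null_integral => // w.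
  by rewrite mule_ge0// ?lee_fin// expeR_ge0.
move=> w /= /negP; rewrite negbK => /eqP gw p _.
have [|t [_ [z [/andP[sz zt] Xz]]]] := @g_gt_zero_in (s p) w; first by rewrite gw ltry.
have [n zn] : exists n, z <= s p + n.+1%:R.
  by exists (Num.truncn z); rewrite ltW// (lt_trans (truncnS_gt z))// ltrDr.
by exists n => //; exists z; rewrite sz.
Qed.

End penalised.

(** * Predictable events at the last zero *)

Section last_zero.
Variable R : realType.
Implicit Types (s t u v : R) (w : Omega R) (A : set (Omega R)).

(** [at_g] evaluates processes at [fine (g w)], which is 0 when the zeros are
    unbounded; [late] is therefore the preimage of ]u, +oo[ under the time that
    [at_g] uses, whereas [after] is the event that there is a zero after [u]. *)
Definition late u : set (Omega R) := [set w | u < fine (g w)].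

Definition after u : set (Omega R) := [set w | (u%:E < g w)%E].

Lemma afterP u w : 0 <= u ->
  after u w <-> exists z, u < z /\ X z w = 0.
Proof.
move=> u0; split=> [/ereal_sup_gt[_ [z [_ Xz] <-]]|[z [uz Xz]]].
  by rewrite lte_fin; exists z.
apply: (@lt_le_trans _ _ z%:E); first by rewrite lte_fin.
by apply: ereal_sup_ubound; exists z => //; split=> //; rewrite (le_trans u0)// ltW.
Qed.

(** The intervals increase, and they start at positive times, at which the path
    is almost surely not 0. *)
Lemma bigcup_zero_in_after u : 0 <= u ->
  after u = \bigcup_n zero_in (u + n.+1%:R^-1) (u + n.+2%:R).
Proof.
move=> u0; apply/seteqP; split=> [w /(afterP _ u0)[z [uz Xz]]|w [n _ [z [/andP[uz _] Xz]]]].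
  have [n nz] := ltr_add_invr uz.
  exists (maxn n (Num.truncn z)) => //; exists z; split => //.
  apply/andP; split.
    rewrite (le_trans _ (ltW nz))// lerD2l lef_pV2 ?posrE//.
    by rewrite ler_nat ltnS leq_maxl.
  apply: (@le_trans _ _ (Num.truncn z).+1%:R); first by rewrite ltW// truncnS_gt.
  by rewrite -[leLHS]add0r lerD// ler_nat ltnS leqW// leq_maxr.
by apply/(afterP _ u0); exists z; split=> //; rewrite (lt_le_trans _ uz)// ltrDl.
Qed.

Lemma measurable_after u : 0 <= u -> measurable (after u).
Proof.
move=> u0; rewrite bigcup_zero_in_after//; apply: bigcup_measurable => n _.
have h : 0 <= u + n.+2%:R :> R by rewrite addr_ge0.
by apply: (Ft_measurable_set h); apply: Ft_zero_in; rewrite addr_ge0.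
Qed.

Lemma lateE u : 0 <= u -> late u = after u `\` \bigcap_n after n%:R.
Proof.
have le0 : u < 0 -> 0 <= u -> False by move=> u1; rewrite leNgt u1.
move=> u0; apply/seteqP; split=> [w|w []]; rewrite /late/= /after/=.
  case gw : (g w) => [r| |] /= ur; try by case: (le0 ur u0).
  rewrite lte_fin; split=> // /(_ (Num.truncn r).+1 I).
  by rewrite /= gw lte_fin ltNge ltW// truncnS_gt.
case gw : (g w) => [r| |] //=.
by move=> _ []; move=> n _ /=; rewrite gw ltry.
Qed.

Lemma measurable_late u : 0 <= u -> measurable (late u).
Proof.
move=> u0; rewrite lateE//; apply: measurableD; first exact: measurable_after.
by apply: bigcapT_measurable => n; exact: measurable_after.
Qed.

Lemma late_afterP u w : 0 <= u -> g w != +oo%E -> late u w <-> after u w.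
Proof.
move=> u0 goo; rewrite /late/after/=; case: (g w) goo => [r| |] _ //=.
by split; rewrite // ltNge u0.
Qed.

Lemma fine_g_ge0 w : 0 <= fine (g w).
Proof.
case gw : (g w) => [r| |] //=; rewrite -lee_fin -gw.
have [E|/set0P[_ [t [t0 Xt] _]]] :=
    eqVneq [set t%:E | t in [set t | 0 <= t /\ X t w = 0]] set0.
  by move: gw; rewrite /g E ereal_sup0.
apply: (@le_trans _ _ t%:E); first by rewrite lee_fin.
by apply: ereal_sup_ubound; exists t.
Qed.

Lemma predictable_after u A : 0 <= u -> Ft u A ->
  <<s @predictable_rect R >> (`]u, +oo[%classic `*` A).
Proof.
move=> u0 FA.
rewrite (_ : _ `*` _ = \bigcup_n (`]u, u + n%:R]%classic `*` A)).
  apply: (@bigcup_measurable _ (g_sigma_algebraType (@predictable_rect R))) => n _.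
  by apply: sub_sigma_algebra; right; exists u, (u + n%:R), A; split=> //; rewrite lerDl.
apply/seteqP; split=> [[s w] [/=]|[s w] [n _ [/=]]]; rewrite !in_itv/=.
  rewrite andbT => us Aw; exists (Num.truncn (s - u)).+1 => //; split=> //=.
  by rewrite in_itv/= us -lerBlDl ltW// truncnS_gt.
by move=> /andP[-> _].
Qed.

Lemma predictable_from0 A : Ft 0 A ->
  <<s @predictable_rect R >> (@Rplus R `*` A).
Proof.
move=> FA; rewrite (_ : _ `*` _ = ([set 0] `*` A) `|` (`]0, +oo[%classic `*` A)).
  apply: (@measurableU _ (g_sigma_algebraType (@predictable_rect R))).
    by apply: sub_sigma_algebra; left; exists A.
  exact: predictable_after.
apply/seteqP; split=> [[s w] [/=]|[s w]]; rewrite /Rplus/= !in_itv/= ?andbT.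
  by rewrite le_eqVlt => /predU1P[<-|s0] Aw; [left|right].
by case=> -[/= s0 Aw]; split=> //; rewrite ?s0// ltW.
Qed.

Lemma predictable_indic C : <<s @predictable_rect R >> C ->
  predictable (fun s w => \1_C (s, w) : R).
Proof.
move=> mC; rewrite /predictable; apply: measurable_funTS.
rewrite (_ : (fun p => _) = \1_C); last by apply/funext => -[].
exact: (@measurable_indic _ (g_sigma_algebraType (@predictable_rect R))).
Qed.

Lemma predictable_setI (k : R -> Omega R -> R) (B : set R) :
  predictable k -> measurable B ->
  <<s @predictable_rect R >> ((@Rplus R `*` setT) `&` (fun p => k p.1 p.2) @^-1` B).
Proof. by move=> mk mB; apply: mk => //; exact: predictable_from0 (@Ft_setT _ 0). Qed.

Variables (mu : {measure set (Omega R) -> \bar R}) (F : Omega R -> R).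
Hypothesis intF : mu.-integrable setT (EFin \o F).
Hypothesis F_late : forall u A, 0 <= u -> Ft u A ->
  \int[mu]_(w in A `&` late u) F w = 0.
Hypothesis F_init : forall A, Ft 0 A -> \int[mu]_(w in A) F w = 0.

(** The events [A `&` late u] with [A] in F_u, together with F_0, generate the
    sigma-algebra F_g of the predictable events at the last zero: this is the
    pi-lambda theorem for the predictable rectangles. *)
Lemma Rintegral_predictable_eq0 C : <<s @predictable_rect R >> C ->
  measurable [set w | C (fine (g w), w)] /\
  \int[mu]_(w in [set w | C (fine (g w), w)]) F w = 0.
Proof.
pose h w := (fine (g w), w); pose H C := measurable (h @^-1` C) /\
  \int[mu]_(w in h @^-1` C) F w = 0.
suff: <<s @predictable_rect R >> `<=` H by apply.
apply: lambda_system_subset => //.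
- move=> A B; case=> [[A' FA <-]|[s [t [A' [s0 st FA ->]]]]];
    case=> [[B' FB <-]|[u [v [B' [u0 uv FB ->]]]]]; rewrite -setXI.
  + left; exists (A' `&` B'); first exact: Ft_setI.
    by rewrite setIid.
  + right; exists 0, 0, setT; split => //; first exact: Ft_setT.
    rewrite set_itvoc0 set0X -subset0 => -[x w] [[/= x0 +] _].
    by rewrite x0 in_itv/= ltNge u0.
  + right; exists 0, 0, setT; split => //; first exact: Ft_setT.
    rewrite set_itvoc0 set0X -subset0 => -[x w] [[/= + x0] _].
    by rewrite x0 in_itv/= ltNge s0.
  (* the outer maximum turns an empty intersection into an empty interval *)
  + right; exists (Num.max s u), (Num.max (Num.max s u) (Num.min t v)), (A' `&` B').
    split; [by rewrite le_max s0|by rewrite le_max lexx| |].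
      apply: Ft_setI; [apply: Ft_le FA|apply: Ft_le FB]; by rewrite le_max lexx ?orbT.
    congr (_ `*` _); apply/seteqP; split=> x /=; rewrite !in_itv/=.
      case=> /andP[sx xt] /andP[ux xv].
      by rewrite gt_max sx ux/= le_max le_min xt xv orbT.
    case/andP=> mx; rewrite le_max leNgt mx/= le_min => /andP[xt xv].
    by move: mx; rewrite gt_max xt xv => /andP[-> ->].
- split=> //.
  + split; first by rewrite preimage_setT.
    by rewrite preimage_setT; apply: F_init; exact: Ft_setT.
  + move=> A B BA [mA A0] [mB B0]; split; first exact: (measurableD mA mB).
    have := Rintegral_setD intF mA mB (preimage_subset BA).
    by rewrite A0 B0 add0r => /esym.
  + move=> A ndA HA; rewrite /H preimage_bigcup; split.
      by apply: bigcup_measurable => n _; case: (HA n).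
    apply: (Rintegral_nondecreasing_eq0 intF) => [n| |n]; try by case: (HA n).
    by move=> i j ij; apply/subsetPset; apply: preimage_subset; exact/subsetPset/ndA.
- move=> A; case=> [[A' FA <-]|[s [t [A' [s0 st FA ->]]]]].
  + have mA : measurable A' := Ft_measurable_set (lexx 0) FA.
    have mL : measurable (A' `&` late 0) by apply: measurableI => //; exact: measurable_late.
    have E : h @^-1` ([set 0] `*` A') = A' `\` (A' `&` late 0).
      apply/seteqP; split=> [w [/= g0 Aw]|w [Aw nL]]; split=> //=.
        by move=> -[_]; rewrite /late/= g0 ltxx.
      apply/eqP; rewrite eq_le fine_g_ge0 andbT leNgt; apply/negP => L.
      exact: nL.
    rewrite /H E; split; first exact: measurableD.
    have := Rintegral_setD intF mA mL (@subIsetl _ _ _).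
    by rewrite F_init// F_late// add0r.
  + have t0 := le_trans s0 st.
    have mA : measurable A' := Ft_measurable_set s0 FA.
    have mL u : 0 <= u -> measurable (A' `&` late u).
      by move=> u0; apply: measurableI => //; exact: measurable_late.
    have E : h @^-1` (`]s, t]%classic `*` A') = (A' `&` late s) `\` (A' `&` late t).
      apply/seteqP; split=> [w [/= + Aw]|w [[Aw sw] nL]].
        rewrite in_itv/=; case/andP => sw wt; split=> // -[_].
        by rewrite /late/= ltNge wt.
      split=> //=; rewrite in_itv/= [_ < _]sw/= leNgt; apply/negP => L.
      exact: nL.
    rewrite /H E; split; first by apply: measurableD; exact: mL.
    have sub : A' `&` late t `<=` A' `&` late s.
      by move=> w [Aw tw]; split=> //; exact: le_lt_trans st tw.
    have := Rintegral_setD intF (mL s s0) (mL t t0) sub.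
    by rewrite !F_late ?add0r//; exact: Ft_le st _ FA.
Qed.

End last_zero.

(** * Vanishing of the martingale on the zeros *)

Section equivalence.
Variable R : realType.
Variables (W Wd : probability (Omega R) R) (l : R -> R -> Omega R -> R).
Variables (WW : {measure set (Omega R) -> \bar R}).
Hypotheses (hW : is_wiener W) (hl : is_local_time W l).
Hypotheses (hWd : is_W_delta0 W (l 0) Wd) (hWW : is_bold_W (l 0) Wd WW).
Variables (F : Omega R -> R) (M k : R -> Omega R -> R).
Hypothesis hF : WW.-integrable setT (EFin \o F).
Hypothesis hM : is_M W WW F M.
Hypothesis hk : is_k W (l 0) WW F k.
Implicit Types (s t u v : R) (w : Omega R) (A : set (Omega R)).

Let adaptedM t : 0 <= t -> Ft_measurable t (M t).
Proof. by case: hM => -[h _ _ _] _; exact: h. Qed.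

Let integrableM t : 0 <= t -> W.-integrable setT (EFin \o M t).
Proof. by case: hM => -[_ h _ _] _; exact: h. Qed.

Let continuousM : {ae W, forall w, {within @Rplus R, continuous (fun t => M t w)}}.
Proof. by case: hM => -[_ _ _ h] _; exact: h. Qed.

Lemma Rintegral_M t A : 0 <= t -> Ft t A ->
  \int[WW]_(w in A) F w = \int[W]_(w in A) M t w.
Proof.
move=> t0 FA; rewrite -[LHS]Rintegral_indic -[RHS]Rintegral_indic; congr fine.
apply: hM.2 => //.
  apply: (@measurable_indic _ (g_sigma_algebraType (Ft t)) R setT A).
  exact: sub_sigma_algebra.
by exists 1 => w; rewrite indicE; case: (w \in A); rewrite ?normr0 ?normr1.
Qed.

Lemma Rintegral_k C : <<s @predictable_rect R >> C ->
  \int[WW]_(w in [set w | C (fine (g w), w)]) F w =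
  \int[WW]_(w in [set w | C (fine (g w), w)]) at_g k w.
Proof.
move=> mC; rewrite -[LHS]Rintegral_indic -[RHS]Rintegral_indic; congr fine.
have [_ _ _ /(_ _ (predictable_indic mC))[|_ H]] := hk.
  by exists 1 => t w _; rewrite indicE; case: (_ \in C); rewrite ?normr0 ?normr1.
have E w : at_g (fun s w => \1_C (s, w)) w = \1_[set w | C (fine (g w), w)] w :> R.
  by rewrite /at_g !indicE; congr (_%:R); congr nat_of_bool;
    apply/idP/idP => /set_mem H0; apply/mem_set.
transitivity (\int[WW]_w (at_g (fun s w => \1_C (s, w)) w * F w)%:E)%E.
  by apply: eq_integral => w _; rewrite E mulrC.
by rewrite H; apply: eq_integral => w _; rewrite E mulrC.
Qed.

Let martingaleM (c : R) s t u v A : 0 <= s -> s <= u -> u <= v -> v <= t -> Ft u A ->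
  \int[W]_(w in A) (c * M v w) = \int[W]_(w in A) (c * M u w).
Proof.
move=> s0 su uv _ FA; have u0 := le_trans s0 su; have v0 := le_trans u0 uv.
have mA : measurable A := Ft_measurable_set u0 FA.
rewrite !RintegralZl//; try exact: (integrable_on (integrableM _)).
by rewrite -(Rintegral_M u0 FA) -(Rintegral_M v0)//; exact: Ft_le uv _ FA.
Qed.

Let adaptedcM (c : R) s t u : 0 <= s -> s <= u -> u <= t ->
  Ft_measurable u (fun w => c * M u w).
Proof.
move=> s0 su _; apply: measurable_funM; first exact: measurable_cst.
by apply: adaptedM; exact: le_trans su.
Qed.

Let integrablecM (c : R) s t u : 0 <= s -> s <= u -> u <= t ->
  W.-integrable setT (EFin \o (fun w => c * M u w)).
Proof.
move=> s0 su _.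
have := integrableZl measurableT c (integrableM (le_trans s0 su)).
by apply: eq_integrable.
Qed.

Let continuouscM (c : R) s t : 0 <= s ->
  {ae W, forall w, {within `[s, t], continuous (fun u => c * M u w)}}.
Proof.
move=> s0; apply: filterS continuousM => w cw.
have {}cw : {within `[s, t], continuous (fun u => M u w)}.
  apply: continuous_subspaceW cw => u /=; rewrite /Rplus/= !in_itv/= andbT => /andP[su _].
  exact: le_trans su.
by move=> u; apply: cvgM; [exact: cvg_cst|exact: cw].
Qed.

(** By [first_zero_le0] applied to [M] and [- M], almost surely [M] vanishes at
    the first zero after each rational time. Any positive zero is a limit of
    such first zeros, and [M] is continuous. The time 0 is handled
    separately, by F_0. *)
Lemma vanishing_M :
  (forall u A, 0 <= u -> Ft u A -> \int[WW]_(w in A `&` late u) F w = 0) ->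
  (forall A, Ft 0 A -> \int[WW]_(w in A) F w = 0) ->
  {ae W, forall w t, 0 <= t -> X t w = 0 -> M t w = 0}.
Proof.
move=> F_late F_init.
have hit0 s u v A : 0 <= s -> s <= u -> u <= v -> Ft u A ->
    \int[W]_(w in A `&` (zero_in s v `\` zero_in s u)) M v w = 0.
  move=> s0 su uv FA; have u0 := le_trans s0 su; have v0 := le_trans u0 uv.
  pose B := A `\` zero_in s u; pose B' := B `\` zero_in s v.
  have FB : Ft u B by apply: Ft_setD => //; exact: Ft_zero_in.
  have FB' : Ft v B'.
    by apply: Ft_setD; [exact: Ft_le uv _ FB|exact: Ft_zero_in].
  have FE := Ft_first_hit s0 uv FA.
  have mBl : measurable (B `&` late u).
    by apply: measurableI; [exact: Ft_measurable_set FB|exact: measurable_late].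
  have mBl' : measurable (B' `&` late v).
    by apply: measurableI; [exact: Ft_measurable_set FB'|exact: measurable_late].
  have sub : B' `&` late v `<=` B `&` late u.
    by move=> w [[Bw _] vw]; split=> //; exact: le_lt_trans uv vw.
  (* off the zeros in [s, u], a zero in [s, v] means that the last zero comes
     after u, unless it comes after v without a zero in [s, v] *)
  rewrite -(Rintegral_M v0 FE).
  rewrite (@eq_Rintegral_ae_set _ _ _ _ _ hF _ ((B `&` late u) `\` (B' `&` late v))).
  - have := Rintegral_setD hF mBl mBl' sub.
    by rewrite !F_late// add0r => /esym.
  - exact: Ft_measurable_set FE.
  - exact: measurableD.
  - have := g_finite hW hl hWd hWW; apply: filterS => w goo.
    split=> [[Aw [sv nsu]]|[[[Aw nsu] uw] nB']].
      split; last by move=> -[[_ /(_ sv)]].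
      split=> //; apply/(late_afterP u0 goo)/afterP => //.
      have [z [/andP[sz zv] Xz]] := sv; exists z; split=> //.
      by rewrite ltNge; apply/negP => zu; apply: nsu; exists z; rewrite sz.
    split=> //; split=> //.
    have [//|nsv] := pselect (zero_in s v w).
    exfalso; apply: nB'; split=> //.
    have [z [uz Xz]] := (afterP w u0).1 ((late_afterP u0 goo).1 uw).
    apply/(late_afterP v0 goo)/afterP => //; exists z; split=> //.
    rewrite ltNge; apply/negP => zv; apply: nsv; exists z.
    by rewrite zv (le_trans su (ltW uz)).
have first0 (c s t : R) : 0 < s -> s < t ->
    {ae W, forall w z, first_zero s w z -> s < z -> z <= t -> c * M z w <= 0}.
  move=> s0 st; have s0' := ltW s0.
  apply: (@first_zero_le0 R W s t (fun u w => c * M u w) s0' st).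
  - by move=> u su ut; exact: adaptedcM s0' su ut.
  - by move=> u su ut; exact: integrablecM s0' su ut.
  - by move=> u v A su uv vt; exact: martingaleM s0' su uv vt.
  - exact: continuouscM.
  - move=> u v A su uv _ FA; have v0 := le_trans (le_trans s0' su) uv.
    have mE := Ft_measurable_set v0 (Ft_first_hit s0' uv FA).
    by rewrite RintegralZl ?hit0 ?mulr0//; exact: (integrable_on (integrableM v0)).
have first_rat (n : nat) : {ae W, forall w,
    if unpickle n is Some q then 0 < ratr q :> R -> X (ratr q) w != 0 /\
      forall (j : nat) z, first_zero (ratr q) w z -> ratr q < z ->
        z <= ratr q + j.+1%:R -> M z w = 0
    else True}.
  case: (@unpickle rat n) => [q|]; last exact: aeW.
  have [q0|nq] := ltP 0 (ratr q : R); last first.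
    exact: aeW.
  have qj (j : nat) : ratr q < ratr q + j.+1%:R :> R by rewrite ltrDl.
  have H c : {ae W, forall w (j : nat) z, first_zero (ratr q) w z -> ratr q < z ->
      z <= ratr q + j.+1%:R -> c * M z w <= 0}.
    by apply/ae_foralln => j; exact: first0.
  have := wiener_neq0 hW q0; apply: filterS3 (H 1) (H (-1)) => w H1 H2 Xq _.
  split=> // j z fz qz zj; apply/eqP; rewrite eq_le.
  by have := H1 j z fz qz zj; have := H2 j z fz qz zj; rewrite mul1r mulN1r oppr_le0 => -> ->.
have M0 : {ae W, forall w, M 0 w = 0}.
  have FP : Ft 0 [set w | 0 < M 0 w].
    rewrite (_ : [set w | _] = M 0 @^-1` `]0, +oo[).
      by apply: Ft_preimage => //; exact: adaptedM.
    by apply/seteqP; split=> w /=; rewrite in_itv/= andbT.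
  have FPc : Ft 0 (~` [set w | 0 < M 0 w]).
    by rewrite -setTD; apply: Ft_setD => //; exact: Ft_setT.
  apply: (ae_eq0_of_Rintegral_sign (integrableM (lexx 0))).
    by rewrite -Rintegral_M// F_init.
  by rewrite -Rintegral_M// F_init.
have := ae_foralln first_rat; apply: filterS3 M0 continuousM => w M0 cw Hq t.
rewrite le_eqVlt => /predU1P[<- _ //|t0 Xt].
apply: contrapT => /eqP Mt.
have e0 : 0 < `|M t w| by rewrite normr_gt0.
have : M u w @[u --> within (@Rplus R) (nbhs t)] --> M t w.
  apply: (subspace_continuousP _ _).1 cw _ _.
  by rewrite /Rplus/= in_itv/= andbT ltW.
move/cvgr_dist_lt => /(_ _ e0); rewrite near_withinE => -[/= d d0 Md].
have [q] : exists q, ratr q \in `]Num.max 0 (t - d), t[.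
  by apply: rat_in_itvoo; rewrite gt_max t0 ltrBlDr ltrDl.
rewrite in_itv/= gt_max => /andP[/andP[q0 dq] qt].
have := Hq (pickle q); rewrite pickleK => /(_ q0)[Xq Hz].
have Zt : zero_in (ratr q) t w by exists t; rewrite ltW//= lexx.
have [z zt fz] := zero_in_first Zt; have [qz Xz _] := fz.
have qz' : ratr q < z.
  by rewrite lt_neqAle qz andbT; apply: contraNneq Xq => ->; rewrite Xz.
have Mz : M z w = 0.
  apply: (Hz (Num.truncn z) z fz qz').
  by rewrite ltW// (lt_trans (truncnS_gt z))// ltrDr.
have : `|M t w - M z w| < `|M t w|.
  apply: Md => /=; last by rewrite /Rplus/= in_itv/= andbT (le_trans (ltW q0)).
  by rewrite ger0_norm ?subr_ge0//; lra.
by rewrite Mz subr0 ltxx.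
Qed.

(** Optional stopping, for [M] and [- M], at the first zero after [s], where [M]
    vanishes. *)
Lemma Rintegral_zero_in_eq0 s t A :
  {ae W, forall w t, 0 <= t -> X t w = 0 -> M t w = 0} ->
  0 < s -> s < t -> Ft s A -> \int[WW]_(w in A `&` zero_in s t) F w = 0.
Proof.
move=> HM s0 st FA; have s0' := ltW s0; have t0 := le_trans s0' (ltW st).
have FE := Ft_first_hit s0' (ltW st) FA.
have mE := Ft_measurable_set t0 FE.
have FZ : Ft t (A `&` zero_in s t).
  by apply: Ft_setI; [exact: Ft_le (ltW st) _ FA|exact: Ft_zero_in].
have mZ := Ft_measurable_set t0 FZ.
rewrite (Rintegral_M t0 FZ).
rewrite (@eq_Rintegral_ae_set _ _ _ _ _ (integrableM t0) _ _ mZ mE); last first.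
  apply: filterS (wiener_neq0 hW s0) => w Xs.
  split=> [[Aw Zw]|[Aw []]]; split=> //; split=> // -[z [/andP[sz zs] Xz]].
  have zE : z = s by apply/eqP; rewrite eq_le sz zs.
  by move: Xs; rewrite -zE Xz eqxx.
have int0 : W.-integrable setT (EFin \o (fun=> 0 : R)).
  by apply: eq_integrable (integrable0 W setT).
have le c : c * \int[W]_(w in A `&` (zero_in s t `\` zero_in s s)) M t w <= 0.
  rewrite -RintegralZl//; last exact: (integrable_on (integrableM t0)).
  have := @optional_stopping_le R W s t (fun u w => c * M u w) s0' st _ _ _ _
    (fun=> 0) A.
  rewrite Rintegral_cst// mul0r; apply.
  - by move=> u su ut; exact: adaptedcM s0' su ut.
  - by move=> u su ut; exact: integrablecM s0' su ut.
  - by move=> u v B su uv vt; exact: martingaleM s0' su uv vt.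
  - exact: continuouscM.
  - exact: measurable_cst.
  - exact: int0.
  - exact: FA.
  - apply: filterS HM => w Mw z [_ Xz _] sz _.
    by rewrite Mw ?mulr0// (le_trans s0')// ltW.
apply/eqP; rewrite eq_le; have := le 1; have := le (-1).
by rewrite mul1r mulN1r oppr_le0 => -> ->.
Qed.

Lemma Rintegral_init_eq0 A :
  {ae W, forall w t, 0 <= t -> X t w = 0 -> M t w = 0} ->
  Ft 0 A -> \int[WW]_(w in A) F w = 0.
Proof.
move=> HM FA; rewrite (Rintegral_M (lexx 0) FA).
have mA := Ft_measurable_set (lexx 0) FA.
have X0 : {ae W, forall w, X 0 w = 0}.
  have mX : measurable [set w | X 0 w = 0 :> R].
    rewrite -[X in measurable X]setTI.
    exact: (Ft_measurable_fun (lexx 0) (Ft_measurable_X (lexx 0)) measurableT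
      (measurable_set1 0)).
  exists (~` [set w | X 0 w = 0]); split=> //; first exact: measurableC.
  by rewrite probability_setC// hW.1 subee.
have mM : measurable [set w | M 0 w = 0].
  exact: (Ft_measurable_set (lexx 0) (Ft_preimage (adaptedM (lexx 0)) (measurable_set1 0))).
rewrite (@eq_Rintegral_ae_set _ _ _ _ _ (integrableM (lexx 0)) _
  (A `&` [set w | M 0 w = 0]))//.
- transitivity (\int[W]_(w in A `&` [set w | M 0 w = 0]) (0 : R)).
    by apply: eq_Rintegral => w /set_mem[].
  by rewrite Rintegral_cst ?mul0r//; exact: measurableI.
- exact: measurableI.
- by apply: filterS2 X0 HM => w X0 Mw; split=> [Aw|[]//]; split=> //; exact: Mw.
Qed.

Lemma late_of_vanishing_M u A :
  {ae W, forall w t, 0 <= t -> X t w = 0 -> M t w = 0} ->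
  0 <= u -> Ft u A -> \int[WW]_(w in A `&` late u) F w = 0.
Proof.
move=> HM u0 FA; have mA := Ft_measurable_set u0 FA.
rewrite (@eq_Rintegral_ae_set _ _ _ _ _ hF _ (A `&` after u)); last 3 first.
- by apply: measurableI => //; exact: measurable_late.
- by apply: measurableI => //; exact: measurable_after.
- have := g_finite hW hl hWd hWW; apply: filterS => w goo.
  by split=> -[Aw /(late_afterP u0 goo)].
rewrite bigcup_zero_in_after// setI_bigcupr.
have pos n : 0 < u + n.+1%:R^-1 :> R by rewrite ltr_wpDl// invr_gt0.
have mZ n : measurable (A `&` zero_in (u + n.+1%:R^-1) (u + n.+2%:R)).
  apply: measurableI => //; apply: (@Ft_measurable_set _ (u + n.+2%:R)).
    by rewrite addr_ge0.
  by apply: Ft_zero_in; exact: ltW.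
apply: (Rintegral_nondecreasing_eq0 hF mZ) => [i j ij|n].
  apply/subsetPset; apply: setIS => w [z [/andP[iz zi] Xz]].
  exists z; split=> //; apply/andP; split.
    by rewrite (le_trans _ iz)// lerD2l lef_pV2 ?posrE// ler_nat.
  by rewrite (le_trans zi)// lerD2l ler_nat.
apply: Rintegral_zero_in_eq0 => //.
  rewrite ltrD2l (@le_lt_trans _ _ 1)// ?ltr1n// invf_le1//.
  by rewrite ler1n.
by apply: Ft_le FA; rewrite lerDl.
Qed.

End equivalence.

Theorem theorem1p2p12 (R : realType)
    (W : probability (Omega R) R) (hW : is_wiener W)
    (l : R -> R -> Omega R -> R) (hl : is_local_time W l)
    (Wd : probability (Omega R) R) (hWd : is_W_delta0 W (l 0) Wd)
    (WW : {measure set (Omega R) -> \bar R}) (hWW : is_bold_W (l 0) Wd WW)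
    (F : Omega R -> R) (hF : WW.-integrable setT (EFin \o F))
    (M : R -> Omega R -> R) (hM : is_M W WW F M)
    (k : R -> Omega R -> R) (hk : is_k W (l 0) WW F k) :
  {ae W, forall w, forall t, 0 <= t -> X t w = 0 -> M t w = 0} <->
  {ae WW, forall w, at_g k w = 0}.
Proof.
split=> [HM|k0].
  have [mk _ intk _] := hk.
  have late0 u A u0 FA := late_of_vanishing_M hW hl hWd hWW hF hM HM
    (u := u) (A := A) u0 FA.
  have init0 A FA := Rintegral_init_eq0 hW hM HM (A := A) FA.
  have F0 := Rintegral_predictable_eq0 hF late0 init0.
  (* the process k is measurable on nonnegative times only, and fine (g w) is
     one of them *)
  have at_gE (B : set R) : [set w | ((@Rplus R `*` setT) `&`
      (fun p => k p.1 p.2) @^-1` B) (fine (g w), w)] = at_g k @^-1` B.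
    apply/seteqP; split=> [w [_]//|w Bw]; split=> //; split=> //=.
    by rewrite /Rplus/= in_itv/= andbT fine_g_ge0.
  have sign (B : set R) : measurable B ->
      \int[WW]_(w in at_g k @^-1` B) at_g k w = 0.
    move=> mB; have mC := predictable_setI mk mB.
    by rewrite -at_gE -(Rintegral_k hk mC); exact: (F0 _ mC).2.
  (* over the two F_g-events given by the sign of at_g k, F and at_g k have the
     same integral, which is 0 *)
  apply: (ae_eq0_of_Rintegral_sign intk).
    rewrite (_ : [set w | _] = at_g k @^-1` `]0, +oo[); first exact: sign.
    by apply/seteqP; split=> w /=; rewrite in_itv/= andbT.
  rewrite (_ : ~` _ = at_g k @^-1` `]-oo, 0]); first exact: sign.
  by apply/seteqP; split=> w /=; rewrite in_itv/= leNgt => /negP.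
have [_ _ intk _] := hk.
have zero C : <<s @predictable_rect R >> C ->
    measurable [set w | C (fine (g w), w)] ->
    \int[WW]_(w in [set w | C (fine (g w), w)]) F w = 0.
  move=> mC mgC; rewrite (Rintegral_k hk mC) /Rintegral.
  rewrite (@ae_eq_integral _ _ _ _ _ (cst 0%E)) ?integral0//.
    exact: measurable_int (integrable_on intk mgC).
  by apply: filterS k0 => w k0 _; rewrite /= k0.
apply: (vanishing_M hW hl hWd hWW hF hM) => [u A u0 FA|A FA].
  have E : [set w | (`]u, +oo[%classic `*` A) (fine (g w), w)] = A `&` late u.
    by apply/seteqP; split=> w [] /=; rewrite in_itv/= andbT.
  rewrite -E; apply: zero; first exact: predictable_after.
  rewrite E; apply: measurableI; last exact: measurable_late.
  exact: Ft_measurable_set FA.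
have E : [set w | (@Rplus R `*` A) (fine (g w), w)] = A.
  apply/seteqP; split=> [w []//|w Aw]; split=> //=.
  by rewrite /Rplus/= in_itv/= andbT fine_g_ge0.
rewrite -E; apply: zero; first exact: predictable_from0.
by rewrite E; exact: Ft_measurable_set FA.
Qed.
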